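(* Let $n\in\mathbb{C}\setminus\{0,-\tfrac12,-1,-\tfrac32,-2\}$, $p,p'\in\mathbb{Z}_2$, $\lambda,\mu,\lambda',\mu'\in\mathbb{C}$, $\delta=\mu-\lambda$, $\delta'=\mu'-\lambda'$. The SVC is necessary for $\mathrm{SQ}^{\delta-n,p,6}_{\lambda,\mu}\cong\mathrm{SQ}^{\delta'-n,p',6}_{\lambda',\mu'}$. Moreover: (i) Suppose $p=p'=0$. If $\delta-n$ or $\delta'-n$ lies in $\{0,1,2\}$, or if at least one of $B^0_{n+5/2,n}$, $B^1_{n+2,n+1/2}$, $B^1_{n+5/2,n+1/2}$, $B^0_{n+2,n}$ vanishes at $(\gamma,\delta)$ or at $(\gamma',\delta')$, then the SVC is also sufficient for equivalence. Otherwise the subquotients are equivalent if and only if they satisfy the SVC and $I^0_n(\gamma,\delta)=I^0_n(\gamma',\delta')$. (ii) Suppose $p=p'=1$. If $\delta-n$ or $\delta'-n$ lies in $\{\tfrac12,\tfrac32\}$, or if at least one of $B^1_{n+5/2,n}$, $B^0_{n+2,n+1/2}$, $B^0_{n+5/2,n+1/2}$, $B^1_{n+2,n}$ vanishes at $(\gamma,\delta)$ or at $(\gamma',\delta')$, then the SVC is also sufficient. Otherwise the subquotients are equivalent if and only if they satisfy the SVC and $I^1_n(\gamma,\delta)=I^1_n(\gamma',\delta')$. (iii) Suppose $p=0$, $p'=1$. If $S^0_{i,j}(\gamma,\delta)=0$ or $S^1_{i,j}(\gamma',\delta')=0$ for at least one $(i,j)\in\{(\tfrac52,0),(2,\tfrac12),(\tfrac52,\tfrac12),(2,0)\}$,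 then the SVC is also sufficient. Otherwise the subquotients are equivalent if and only if they satisfy the SVC and $I^0_n(\gamma,\delta)=I^1_n(\gamma',\delta')$.
   Context: Work over $\mathbb{C}$ on the superline $\mathbb{R}^{1|1}$ in the polynomial category. Let $\mathbb{C}[x,\xi]$ be the polynomial superalgebra with even $x$ and odd $\xi$ ($\xi^2=0$), $D=\partial_\xi+\xi\partial_x$, $\bar D=\partial_\xi-\xi\partial_x$; $X_F=F\partial_x+\tfrac12 D(F)\bar D$ for $F\in\mathbb{C}[x,\xi]$, and $\mathcal{K}=\{X_F\}$ (contact vector fields). $V^{p\Pi}$ is $V$ for $p$ even and $V$ with parity reversed for $p$ odd. For $\nu\in\mathbb{C}$, $\mathcal{F}_\nu=\alpha^\nu\mathbb{C}[x,\xi]$ ($\alpha^\nu$ formal, even), $L_\nu(X_F)(\alpha^\nu G)=\alpha^\nu(X_F(G)+\nu\,\partial_x(F)\,G)$. For $z\in\mathbb{C}$, $\bar D^z_0=e^{i\pi z/2}\partial_x^{z/2}$ (even), $\bar D^z_1=e^{i\pi(z-1)/2}\partial_x^{(z-1)/2}\bar D$ (odd). For $\lambda,\mu,k\in\mathbb{C}$, $p\in\mathbb{Z}_2$, $\delta=\mu-\lambda$: $\Psi^{k,p}_{\lambda,\mu}=\{\alpha^{\delta}\sum_{j\in\mathbb{N}}T_{2k-j}\bar D^{2k-j}_{p+(j\bmod 2)}:T_{2k-j}\in\mathbb{C}[x,\xi]\}$ (formal series), composition via $\bar D^{z'}_{p'}\circ\bar D^z_p=\bar D^{z+z'}_{p+p'}$,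 $[\bar D,\partial_x^z]=0$, $\partial_x^z\circ F=\sum_{j}\binom{z}{j}\partial_x^j(F)\circ\partial_x^{z-j}$, and $\mathcal{K}$-action $L_{\lambda,\mu}(X)(T)=L_\mu(X)\circ T-(-1)^{|X||T|}T\circ L_\lambda(X)$. $\mathrm{SQ}^{k,p,l}_{\lambda,\mu}=\Psi^{k,p}_{\lambda,\mu}/\Psi^{k-l/2,\,p+l}_{\lambda,\mu}$ ($l\in\mathbb{Z}^+$); $\cong$ is $\mathcal{K}$-equivalence of any parity. Set $\gamma^{1/2}=\sqrt3(\lambda+\mu-\tfrac12)$, $\gamma=(\gamma^{1/2})^2$, $\gamma^{3/2}=\gamma\gamma^{1/2}$, and similarly $\gamma',\delta'$ for $(\lambda',\mu')$. For $m\in\mathbb{C}$ define functions of $(\gamma,\delta)$ (the superscript $q$ of $B^q_{a,b}$ is read mod 2; subscripts $(a,b)$ mean $m=b$, $r=a-b$): $B^0_{m+3/2,m}=\gamma^{1/2}$; $B^1_{m+3/2,m}=\gamma-3(m+\tfrac12)\delta-\tfrac34$; $B^0_{m+2,m}=\gamma-(m+\tfrac32)(2\delta+m+\tfrac12)$; $B^1_{m+2,m}=\gamma-m(2\delta+m+1)$; $B^0_{m+5/2,m}=\gamma-(m+1)\delta-\tfrac34$; $B^1_{m+5/2,m}=\gamma^{3/2}-\gamma^{1/2}[4(m+1)\delta-(m+1)^2+3]$. Let $(x)_r=x(x-1)\cdots(x-r+1)$, $(x)_0=1$, $\{j\}=j-\lfloor j\rfloor$. For $i,j\in\tfrac12\mathbb{N}$: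 $S^0_{i,j}(\gamma,\delta)=(\delta-n-\lceil j\rceil)_{\lceil i\rceil-\lceil j\rceil}\,B^{2\{j\}}_{n+i,n+j}(\gamma,\delta)$ and $S^1_{i,j}(\gamma,\delta)=(\delta-n-\tfrac12-\lfloor j\rfloor)_{\lfloor i\rfloor-\lfloor j\rfloor}\,B^{1-2\{j\}}_{n+i,n+j}(\gamma,\delta)$. $\mathrm{SQ}^{\delta-n,p,l}_{\lambda,\mu}$ and $\mathrm{SQ}^{\delta'-n,p',l}_{\lambda',\mu'}$ satisfy the SVC (simultaneous vanishing condition) if for all $i,j\in\tfrac12\mathbb{N}$ with $i\le\tfrac12(l-1)$ and $\tfrac32\le i-j\le\tfrac52$, $S^p_{i,j}(\gamma,\delta)$ and $S^{p'}_{i,j}(\gamma',\delta')$ are both zero or both nonzero. Finally, for $p\in\{0,1\}$, $I^p_n=\dfrac{B^p_{n+5/2,n}\,B^{p+1}_{n+2,n+1/2}}{B^{p+1}_{n+5/2,n+1/2}\,B^p_{n+2,n}}$ (a function of $(\gamma,\delta)$). *)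

(* Defs.v *)
From mathcomp Require Import all_boot all_algebra.
From mathcomp Require Import complex.
From mathcomp Require Import reals.

Set Implicit Arguments.
Unset Strict Implicit.
Unset Printing Implicit Defensive.

Import GRing.Theory Num.Theory.
Local Open Scope ring_scope.

Section SuperlineSymbols.
Variable C : numClosedFieldType.

(* A pair (a0, a1) stands for a0(x) + xi * a1(x). *)
Definition SA := ({poly C} * {poly C})%type.

Definition szero : SA := (0, 0).
Definition sadd (A B : SA) : SA := (A.1 + B.1, A.2 + B.2).
Definition sscale (c : C) (A : SA) : SA := (c *: A.1, c *: A.2).
(* (a0 + xi a1)(b0 + xi b1) = a0 b0 + xi (a1 b0 + a0 b1)  (xi^2 = 0) *)
Definition smul (A B : SA) : SA := (A.1 * B.1, A.2 * B.1 + A.1 * B.2).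
Definition sdx (A : SA) : SA := (A.1^`(), A.2^`()).
Definition sdxn (i : nat) (A : SA) : SA := (A.1^`(i), A.2^`(i)).
(* D = partial_xi + xi partial_x,  Dbar = partial_xi - xi partial_x *)
Definition sD (A : SA) : SA := (A.2, A.1^`()).
Definition sDb (A : SA) : SA := (A.2, - A.1^`()).
(* parity involution  G |-> (-1)^{|G|} G  (extended linearly) *)
Definition ssig (A : SA) : SA := (A.1, - A.2).
(* homogeneous element of parity f : false = even P(x), true = odd xi P(x) *)
Definition shom (f : bool) (P : {poly C}) : SA := if f then (0, P) else (P, 0).

Definition XF (F T : SA) : SA :=
  sadd (smul F (sdx T)) (sscale (1 / 2) (smul (sD F) (sDb T))).

Definition cbinom (s : C) (i : nat) : C :=
  (\prod_(t < i) (s - t%:R)) / (i`!)%:R.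

(* Coefficient of Dbar^{w-d}_{q+d} in the composition Dbar^w_q o G, obtained
   from partial_x^z o G = sum_j binom(z,j) partial_x^j(G) partial_x^{z-j},
   Dbar o G = Dbar(G) + (-1)^{|G|} G Dbar and the normalisations
   Dbar^z_0 = e^{i pi z/2} partial_x^{z/2},
   Dbar^z_1 = e^{i pi (z-1)/2} partial_x^{(z-1)/2} Dbar:
     q = 0 : Dbar^w_0 o G = sum_i (-1)^i binom(w/2,i) G^{(i)} Dbar^{w-2i}_0
     q = 1 : Dbar^w_1 o G = sum_i (-1)^i binom((w-1)/2,i)
                  [ (Dbar G)^{(i)} Dbar^{w-1-2i}_0 + ((-1)^{|G|}G)^{(i)} Dbar^{w-2i}_1 ] *)
Definition cf (w : C) (q : bool) (G : SA) (d : nat) : SA :=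
  if ~~ q then
    (if odd d then szero
     else sscale ((-1) ^+ d./2 * cbinom (w / 2) d./2) (sdxn d./2 G))
  else sscale ((-1) ^+ d./2 * cbinom ((w - 1) / 2) d./2)
              (sdxn d./2 (if odd d then sDb G else ssig G)).

(* An element of SQ^{k,p,l}_{lambda,mu} = Psi^{k,p}/Psi^{k-l/2,p+l} is represented
   by its coefficients (T_0, ..., T_{l-1}), standing for
   sum_{j<l} T_j Dbar^{2k-j}_{p + (j mod 2)}. *)
Definition SQsp (l : nat) := {ffun 'I_l -> SA}.

Definition vadd l (u v : SQsp l) : SQsp l := [ffun j => sadd (u j) (v j)].
Definition vscale l (c : C) (u : SQsp l) : SQsp l := [ffun j => sscale c (u j)].

(* Contribution of the input term T Dbar^{2k-j}_{p+j} to the output coefficient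
   of index jo in L_{lambda,mu}(X_F)(T Dbar^{2k-j}) where F is homogeneous of
   parity f:
     L_mu(X_F) o T Dbar^w_q
        = (X_F(T) + mu F' T) Dbar^w_q - F T Dbar^{w+2}_q
          + 1/2 D(F) (-1)^{|T|} T Dbar^{w+1}_{q+1}
   minus (-1)^{|X_F| |T Dbar^w_q|} T Dbar^w_q o (F partial_x + 1/2 D(F) Dbar + lambda F'),
   using partial_x = - Dbar^2_0 and Dbar = Dbar^1_1. *)
Definition contrib (k lam mu : C) (p f : bool) (F T : SA) (j jo : nat) : SA :=
  let w := 2 * k - j%:R in
  let q := p (+) odd j in
  let first :=
    sadd (if (jo == j)%N then sadd (XF F T) (sscale mu (smul (sdx F) T)) else szero)
    (sadd (if (jo + 2 == j)%N then sscale (-1) (smul F T) else szero)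
          (if (jo + 1 == j)%N then sscale (1 / 2) (smul (sD F) (ssig T)) else szero)) in
  let Ts := if f then sscale ((-1) ^+ q) (ssig T) else T in
  let second :=
    sadd (if (j <= jo + 2)%N then sscale (-1) (smul Ts (cf w q F (jo + 2 - j)%N)) else szero)
    (sadd (if (j <= jo + 1)%N then sscale (1 / 2) (smul Ts (cf w q (sD F) (jo + 1 - j)%N))
           else szero)
          (if (j <= jo)%N then sscale lam (smul Ts (cf w q (sdx F) (jo - j)%N)) else szero)) in
  sadd first (sscale (-1) second).

Definition sqact (l : nat) (k lam mu : C) (p : bool) (f : bool) (P : {poly C})
    (v : SQsp l) : SQsp l :=
  [ffun jo : 'I_l => \big[sadd/szero]_(j < l) contrib k lam mu p f (shom f P) (v j) j jo].

(* v is homogeneous of parity r: T_j Dbar^{2k-j}_{p+j} has parity |T_j| + p + j *)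
Definition sq_hom (l : nat) (p r : bool) (v : SQsp l) : Prop :=
  forall j : 'I_l, if r (+) p (+) odd j then (v j).1 = 0 else (v j).2 = 0.

Definition SQequiv (l : nat) (k : C) (p : bool) (lam mu : C)
    (k' : C) (p' : bool) (lam' mu' : C) : Prop :=
  exists (phi : SQsp l -> SQsp l) (e : bool),
    [/\ forall (c : C) (u v : SQsp l),
          phi (vadd (vscale c u) v) = vadd (vscale c (phi u)) (phi v),
        bijective phi,
        forall (r : bool) (v : SQsp l), sq_hom p r v -> sq_hom p' (r (+) e) (phi v) &
        forall (f : bool) (P : {poly C}) (v : SQsp l),
          phi (sqact k lam mu p f P v)
          = vscale ((-1) ^+ (e && f)) (sqact k' lam' mu' p' f P (phi v))].

(* gamma^{1/2} = sqrt 3 (lambda + mu - 1/2), with sqrt 3 the positive root *)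
Definition gam12 (lam mu : C) : C := sqrtC 3 * (lam + mu - 1 / 2).

(* Bf q r2 m g12 d = B^q_{m + r2/2, m} evaluated at gamma^{1/2} = g12, delta = d *)
Definition Bf (q : bool) (r2 : nat) (m g12 d : C) : C :=
  let g := g12 ^+ 2 in
  match r2 with
  | 3 => if q then g - 3 * (m + 1 / 2) * d - 3 / 4 else g12
  | 4 => if q then g - m * (2 * d + m + 1) else g - (m + 3 / 2) * (2 * d + m + 1 / 2)
  | 5 => if q then g12 ^+ 3 - g12 * (4 * (m + 1) * d - (m + 1) ^+ 2 + 3)
         else g - (m + 1) * d - 3 / 4
  | _ => 0
  end.

(* Bat n lam mu q a2 b2 = B^q_{n + a2/2, n + b2/2}(gamma, delta) *)
Definition Bat (n lam mu : C) (q : bool) (a2 b2 : nat) : C :=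
  Bf q (a2 - b2)%N (n + b2%:R / 2) (gam12 lam mu) (mu - lam).

Definition ffall (x : C) (r : nat) : C := \prod_(t < r) (x - t%:R).

(* S^q_{i,j}(gamma,delta) with i = a2/2, j = b2/2:
   ceil(j) = uphalf b2, floor(j) = b2./2, 2{j} = odd b2 *)
Definition Sf (n lam mu : C) (q : bool) (a2 b2 : nat) : C :=
  let d := mu - lam in
  if ~~ q then
    ffall (d - n - (uphalf b2)%:R) (uphalf a2 - uphalf b2)%N * Bat n lam mu (odd b2) a2 b2
  else
    ffall (d - n - 1 / 2 - (b2./2)%:R) (a2./2 - b2./2)%N * Bat n lam mu (~~ odd b2) a2 b2.

(* Simultaneous vanishing condition for SQ^{delta-n,p,l}_{lambda,mu} and
   SQ^{delta'-n,p',l}_{lambda',mu'}: over i = a2/2, j = b2/2 in (1/2)N with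
   i <= (l-1)/2 and 3/2 <= i - j <= 5/2. *)
Definition SVC (l : nat) (n : C) (p : bool) (lam mu : C) (p' : bool) (lam' mu' : C) : Prop :=
  forall a2 b2 : nat, (a2 <= l.-1)%N -> (b2 <= a2)%N -> (3 <= a2 - b2 <= 5)%N ->
    (Sf n lam mu p a2 b2 == 0) = (Sf n lam' mu' p' a2 b2 == 0).

Definition Ifun (p : bool) (n lam mu : C) : C :=
  Bat n lam mu p 5 0 * Bat n lam mu (~~ p) 4 1
  / (Bat n lam mu (~~ p) 5 1 * Bat n lam mu p 4 0).

Definition Ifactor_zero (p : bool) (n lam mu : C) : bool :=
  [|| Bat n lam mu p 5 0 == 0, Bat n lam mu (~~ p) 4 1 == 0,
      Bat n lam mu (~~ p) 5 1 == 0 | Bat n lam mu p 4 0 == 0].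

End SuperlineSymbols.

(* Main.v *)
Require Import Defs.
From mathcomp Require Import all_boot all_algebra.
From mathcomp Require Import complex.
From mathcomp Require Import reals.
From mathcomp Require Import zify ring.

(* Since k = delta - n, the subquotient is filtered by the density modules
   F_(n + j/2), 0 <= j <= 5.  The excluded values of n are the osp(1|2)-resonant
   ones, so there is an osp(1|2)-equivariant splitting T |-> sum_d a_d D^d T
   (the projective quantization).  In the split frame a contact field acts by
   the density actions plus kappa(j, r) times the supertransvectant
   F_(n + j/2) -> F_(n + (j + r)/2), r = 3, 4, 5, which vanishes on osp(1|2).
   An equivalence preserves the lowest weight vectors, hence is diagonal with
   nonzero entries c_j, and it exists if and only if
     kappa(j, r) c_(j + r) = kappa'(j, r) c_j.
   As kappa(j, r) is a nonzero multiple of S_(n + (j + r)/2, n + j/2), the SVC says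
   that both sides have the same zeros; the graph with edges j -> j + r has a
   single cycle 0 - 4 - 1 - 5 - 0, whose holonomy is the invariant I. *)

Set Implicit Arguments.
Unset Strict Implicit.
Unset Printing Implicit Defensive.

Import GRing.Theory Num.Theory.
Local Open Scope ring_scope.

(** * Bilinear operators on the superline *)

Section Superline.
Variable C : numClosedFieldType.
Implicit Types (A B F T : SA C) (c nu lam mu : C) (q : bool) (P : {poly C}).

Lemma saddE A B : sadd A B = A + B. Proof. by []. Qed.
Lemma sscaleE c A : sscale c A = c *: A. Proof. by []. Qed.
Lemma szeroE : @szero C = 0. Proof. by []. Qed.
Definition opsE := (saddE, sscaleE, szeroE).

(** Scalar coefficients turn identities between superfunctions into identities in the field [C],
    which [ring] and [field] can close. *)
Definition scoef (b : bool) (i : nat) A : C := (if b then A.2 else A.1)`_i.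

Lemma scoefD b i A B : scoef b i (A + B) = scoef b i A + scoef b i B.
Proof. by case: b; rewrite /scoef coefD. Qed.

Lemma scoefZ b i c A : scoef b i (c *: A) = c * scoef b i A.
Proof. by case: b; rewrite /scoef coefZ. Qed.

Lemma scoef0 b i : scoef b i 0 = 0.
Proof. by case: b; rewrite /scoef coef0. Qed.

Lemma scoef_inj A B : (forall b i, scoef b i A = scoef b i B) -> A = B.
Proof.
case: A B => [A0 A1] [B0 B1] h; congr pair; apply/polyP => i.
- exact: h false i.
- exact: h true i.
Qed.

Lemma sDD A B : sD (A + B) = sD A + sD B.
Proof. by case: A B => [A0 A1] [B0 B1]; rewrite /sD /= derivD. Qed.

Lemma sDZ c A : sD (c *: A) = c *: sD A.
Proof. by case: A => [A0 A1]; rewrite /sD /= derivZ. Qed.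

Lemma sD0 : sD (0 : SA C) = 0.
Proof. by rewrite /sD /= deriv0. Qed.

(* These bilinear maps are stable under D, with signs independent of the parity
   of F, cf. [sD_bid]. *)
Definition bid (m : nat) F T : SA C :=
  smul (iter m (@sD C) F) (iter m (@ssig C) T).

Lemma iter_sigD m A B :
  iter m (@ssig C) (A + B) = iter m (@ssig C) A + iter m (@ssig C) B.
Proof.
elim: m => //= m ->.
by rewrite {1}/ssig /= opprD.
Qed.

Lemma iter_sigZ m c A : iter m (@ssig C) (c *: A) = c *: iter m (@ssig C) A.
Proof.
elim: m => //= m ->.
by rewrite {1}/ssig /= -scalerN.
Qed.

Lemma smulDr A B T : smul T (A + B) = smul T A + smul T B.
Proof.
by rewrite /smul /= !mulrDr; congr pair; rewrite addrACA.
Qed.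

Lemma smulZr c A T : smul T (c *: A) = c *: smul T A.
Proof.
by rewrite /smul /= -!scalerAr -scalerDr.
Qed.

Lemma bidD m F A B : bid m F (A + B) = bid m F A + bid m F B.
Proof. by rewrite /bid iter_sigD smulDr. Qed.

Lemma bidZ m F c A : bid m F (c *: A) = c *: bid m F A.
Proof. by rewrite /bid iter_sigZ smulZr. Qed.

(** As xi^2 = 0, the product of superfunctions commutes without signs, so the odd Leibniz rule also
    reads D(AB) = D(A) sigma(B) + A D(B), with the sign on the second factor only. Moreover D sigma
    = - sigma D. *)
Lemma sD_bid m F T :
  sD (bid m F T) = bid m.+1 F T + (-1) ^+ m *: bid m F (sD T).
Proof.
have sig_odd A : iter m (@ssig C) A = if odd m then ssig A else A.
  elim: m => //= m ->; case: (odd m) => //=.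
  by case: A => A0 A1; rewrite /ssig /= opprK.
rewrite /bid /= !sig_odd -signr_odd.
case: (iter m _ F) T => [F0 F1] [T0 T1].
by case: (odd m); rewrite /smul /ssig /sD /= ?expr0 ?expr1 ?scale1r ?scaleN1r;
   congr pair; rewrite /= ?(derivD, derivM, derivN, derivE); ring.
Qed.

End Superline.

(** * Action of contact fields on coefficients *)

Section Action.
Variable C : numClosedFieldType.
Implicit Types (A B F T : SA C) (c nu lam mu : C) (q : bool) (P : {poly C}).

(* L_nu(X_F) : T |-> X_F(T) + nu F' T, using Dbar = sigma D *)
Definition Lact nu F T : SA C :=
  bid 0 F (sD (sD T)) + (1 / 2) *: bid 1 F (sD T) + nu *: bid 2 F T.

(* [T Dbar^w_q], with w = 2 (mu - lam - nu), has symbol of density weight nu; the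
   action of X_F maps it to [L_nu(X_F) T] plus the terms [opc e D^(e+2)(F) sigma^e(T)]
   in Dbar^(w-e), cf. [contrib_symb]. *)
Definition opc (lam mu nu : C) (q : bool) (e : nat) : C :=
  let w := 2 * (mu - lam - nu) in
  let y := if q then (w - 1) / 2 else w / 2 in
  let s := uphalf e in
  - (-1) ^+ s *
  (if odd e then cbinom y s / 2 + (if q then lam * cbinom y s.-1 else 0)
   else cbinom y s.+1 + (lam + (if q then 1 / 2 else 0)) * cbinom y s).

Definition symb (lam mu nu : C) (q : bool) (e : nat) F T : SA C :=
  if e is 0 then Lact nu F T else opc lam mu nu q e *: bid e.+2 F T.

Lemma SA_eqP A B : A.1 = B.1 -> A.2 = B.2 -> A = B.
Proof. by case: A B => [? ?] [? ?] /= -> ->. Qed.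

(** In characteristic zero a nonzero [P - Q] would have the distinct roots 0, 1, ..., as many as its
    size. Evaluation makes polynomial identities accessible to [field]. *)
Lemma poly_eq_horner (P Q : {poly C}) : (forall x, P.[x] = Q.[x]) -> P = Q.
Proof.
move=> h; apply/eqP; rewrite -subr_eq0; apply/negPn/negP => nz.
pose rs := [seq i%:R : C | i <- iota 0 (size (P - Q))].
have rootsP : all (root (P - Q)) rs.
  by apply/allP => _ /mapP [i _ ->]; rewrite rootE hornerD hornerN h subrr.
have /(max_poly_roots nz rootsP) : uniq rs.
  by rewrite map_inj_uniq ?iota_uniq // => i j /eqP; rewrite eqr_nat => /eqP.
by rewrite size_map size_iota ltnn.
Qed.

Lemma cbinom0 c : cbinom c 0 = 1.
Proof. by rewrite /cbinom big_ord0 fact0 divr1. Qed.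

(** The commutator does not raise the order: at the indices j - 1 and j - 2 the leading parts of
    L_mu(X_F) o T and T o L_lambda(X_F) cancel, and nothing reaches smaller indices. *)
Lemma contrib_gt (k lam mu : C) p f P T j jo :
  (jo < j)%N -> contrib k lam mu p f (shom f P) T j jo = 0.
Proof.
move=> lt_jo; rewrite /contrib.
have -> : (jo == j) = false by lia.
have -> : (j <= jo)%N = false by lia.
have [->|ne1] := eqVneq j jo.+1.
  rewrite addn1 addn2 eqxx leqnn leqnSn subSnn subnn.
  have -> : (jo.+2 == jo.+1)%N = false by lia.
  rewrite !opsE /cf /= !cbinom0.
  by case: f; case: (p (+) _) => /=; apply: SA_eqP => /=;
    rewrite ?deriv0; apply: poly_eq_horner => x;
    rewrite !(hornerD, hornerN, hornerZ, hornerM, horner0); field.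
have -> : (jo + 1 == j)%N = false by lia.
have -> : (j <= jo + 1)%N = false by lia.
have [->|ne2] := eqVneq j jo.+2.
  rewrite addn2 eqxx leqnn subnn !opsE /cf /= !cbinom0.
  by case: f; case: (p (+) _) => /=; apply: SA_eqP => /=;
    rewrite ?deriv0; apply: poly_eq_horner => x;
    rewrite !(hornerD, hornerN, hornerZ, hornerM, horner0); ring.
have -> : (jo + 2 == j)%N = false by lia.
have -> : (j <= jo + 2)%N = false by lia.
by rewrite !opsE !(scaler0, addr0).
Qed.

Lemma cbinom1 c : cbinom c 1 = c.
Proof. by rewrite /cbinom big_ord1 subr0 divr1. Qed.

(** Since D^2 = partial_x and Dbar = sigma D, every term of [second] is, up to signs, a multiple of
    D^(e+2)(F) T. The bound on e leaves finitely many cases to expand. *)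
Lemma contrib_symb (n lam mu : C) p f P T j e : (e < 6)%N ->
  contrib (mu - lam - n) lam mu p f (shom f P) T j (j + e) =
  symb lam mu (n + j%:R / 2) (p (+) odd j) e (shom f P) T.
Proof.
rewrite /contrib.
have -> : (j + e + 2 == j)%N = false by lia.
have -> : (j + e + 1 == j)%N = false by lia.
have -> : (j <= j + e + 2)%N by lia.
have -> : (j <= j + e + 1)%N by lia.
rewrite leq_addr -!addnA !addKn.
have wE : 2 * (mu - lam - n) - j%:R = 2 * (mu - lam - (n + j%:R / 2)) by field.
move: e => [|e] lt_e.
  { rewrite addn0 eqxx /symb !wE; move: (n + _) (p (+) odd j) => nu q.
  rewrite !opsE /XF !opsE /Lact /cf /bid.
  case: q; case: f => /=; rewrite ?cbinom0 ?cbinom1; apply: SA_eqP => /=.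
  all: rewrite ?(derivN, deriv0) ?(derivn0, derivn1, derivnS) /= ?(derivN, deriv0).
  all: apply: poly_eq_horner => x.
  all: by rewrite !(hornerD, hornerN, hornerZ, hornerM, horner0); field. }
have -> : (j + e.+1 == j)%N = false by lia.
rewrite /symb /opc -wE; move: (2 * _ - _) (p (+) odd j) => w q.
rewrite !opsE /cf.
case: q; case: f; rewrite ?addbF /=.
all: move: e lt_e => [|[|[|[|[|]]]]] //= _.
all: rewrite ?cbinom0; apply: SA_eqP => /=.
all: rewrite ?(derivN, deriv0) ?(derivn0, derivn1, derivnS) /= ?(derivN, deriv0).
all: apply: poly_eq_horner => x.
all: by rewrite !(hornerD, hornerN, hornerZ, hornerM, horner0); field.
Qed.

End Action.

(** * Projective quantization *)

Section Frame.
Variables (C : numClosedFieldType) (lam mu : C).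
Implicit Types (A B F T : SA C) (c nu : C) (q : bool) (P : {poly C}).

(* This recursion is forced by equivariance under F = xi x. *)
Fixpoint qcoef nu q d : C :=
  if d is d'.+1 then
    qcoef nu q d' * opc lam mu (nu + d'%:R / 2) (q (+) odd d') 1
    / (if odd d' then d%:R / 4 else nu + d'%:R / 4)
  else 1.

(* The supertransvectants of F with T, which involve at least five D on F. *)
Definition fbid nu (r : nat) F T : SA C :=
  match r with
  | 3 => bid 5 F T
  | 4 => nu *: bid 6 F T + (3 / 2) *: bid 5 F (sD T)
  | 5 => nu *: bid 7 F T - (1 / 2) *: bid 6 F (sD T) - (3 / 2) *: bid 5 F (sD (sD T))
  | _ => 0
  end.

(* With s = gamma^(1/2) / sqrt 3, this is S up to the nonzero factor [gain]. *)
Definition kap nu q (r : nat) : C :=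
  let s := lam + mu - 1 / 2 in
  let del := mu - lam in
  match r with
  | 3 => if q then
      - (ffall (del - nu - 1 / 2) 1 * (3 * s ^+ 2 - 3 * (nu + 1 / 2) * del - 3 / 4)
         / (12 * (nu + 1 / 2)))
      else - (ffall (del - nu) 2 * s / (4 * (nu + 1 / 2)))
  | 4 => if q then
      - (ffall (del - nu - 1 / 2) 2 * (3 * s ^+ 2 - nu * (2 * del + nu + 1))
         / (24 * nu * (nu + 3 / 2)))
      else
      - (ffall (del - nu) 2 * (3 * s ^+ 2 - (nu + 3 / 2) * (2 * del + nu + 1 / 2))
         / (24 * nu * (nu + 3 / 2)))
  | 5 => if q then
      ffall (del - nu - 1 / 2) 2 * (3 * s ^+ 3 - s * (4 * (nu + 1) * del - (nu + 1) ^+ 2 + 3))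
      / (24 * nu * (nu + 1) * (nu + 2))
      else
      ffall (del - nu) 3 * (3 * s ^+ 2 - (nu + 1) * del - 3 / 4)
      / (24 * nu * (nu + 1) * (nu + 2))
  | _ => 0
  end.

Definition fsymb nu q (r : nat) F T : SA C :=
  if r is 0 then Lact nu F T else kap nu q r *: fbid nu r F T.

Definition quant nu q (d : nat) T : SA C := qcoef nu q d *: iter d (@sD C) T.

(** D^2 = partial_x is an even derivation, so the signs of [sD_bid] cancel. *)
Lemma sD2_bid m F T :
  sD (sD (bid m F T)) = bid m.+2 F T + bid m F (sD (sD T)).
Proof.
rewrite sD_bid sDD sDZ !sD_bid exprS mulN1r scaleNr scalerDr scalerA -expr2 sqrr_sign scale1r.
by rewrite addrA subrK.
Qed.

Lemma symb0 nu q F T : symb lam mu nu q 0 F T = Lact nu F T. Proof. by []. Qed.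
Lemma symbS nu q e F T :
  symb lam mu nu q e.+1 F T = opc lam mu nu q e.+1 *: bid e.+3 F T.
Proof. by []. Qed.

Lemma cbinom2 c : cbinom c 2 = c * (c - 1) / 2.
Proof. by rewrite /cbinom !big_ord_recr big_ord0 /= mul1r subr0. Qed.

Lemma cbinom3 c : cbinom c 3 = c * (c - 1) * (c - 2) / 6.
Proof. by rewrite /cbinom !big_ord_recr big_ord0 /= mul1r subr0. Qed.

Lemma ffall1 c : ffall c 1 = c.
Proof. by rewrite /ffall big_ord1 subr0. Qed.

Lemma ffall2 c : ffall c 2 = c * (c - 1).
Proof. by rewrite /ffall !big_ord_recr big_ord0 /= mul1r subr0. Qed.

Lemma ffall3 c : ffall c 3 = c * (c - 1) * (c - 2).
Proof. by rewrite /ffall !big_ord_recr big_ord0 /= mul1r subr0. Qed.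

(** This is one block of the equivariance of the quantization: quantizing and then acting agrees
    with acting in the split frame and then quantizing. Both sides expand into the terms D^a(F)
    D^b(T) with a + b = e + 2, up to sigma; their coefficients agree as rational functions of nu,
    lambda, mu. *)
Lemma quant_intertwine nu q e F T :
  (e < 6)%N -> (forall t, (t < e)%N -> nu + t%:R / 2 != 0) ->
  \sum_(d < e.+1) symb lam mu (nu + d%:R / 2) (q (+) odd d) (e - d) F (quant nu q d T)
  = \sum_(r < e.+1) quant (nu + r%:R / 2) (q (+) odd r) (e - r) (fsymb nu q r F T).
Proof.
move=> lt_e nz.
(* Each factor of a denominator met below is a constant times some weight nu + t/2. *)
have nzM t c y : (t < e)%N -> c != 0 -> y = c * (nu + t%:R / 2) -> y != 0.
  by move=> /nz nzt c0 ->; apply: mulf_neq0.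
move: e lt_e {nz} nzM => [|[|[|[|[|[|]]]]]] // _ nzM.
all: rewrite !big_ord_recr !big_ord0 /= ?(subn0, subSS, subnn).
all: rewrite !(opsE, addbF, addbT) /quant ?(symb0, symbS) /fsymb ![iter _ _ _]/=.
all: rewrite /Lact /fbid ?scaler0 -?scaleNr.
all: rewrite !(sD2_bid, sD_bid, sDD, sDZ, scalerDr, scalerA, bidD, bidZ, scaler0, sD0).
all: apply: scoef_inj => b i; rewrite !(scoefD, scoefZ, scoef0).
(* The bilinear terms become free variables, so that [field] compares their coefficients. *)
all: repeat match goal with |- context [scoef ?b ?i ?A] =>
  generalize (scoef b i A); intro end.
all: rewrite /= /kap /opc /= ?(cbinom0, cbinom1, cbinom2, cbinom3, ffall1, ffall2, ffall3).
all: case: q => /=; field => //; repeat (apply/andP; split).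
all: first [ by apply: (nzM 0%N 1) => //; [rewrite oner_eq0|field]
  | by apply: (nzM 1%N 2) => //; [rewrite pnatr_eq0|field]
  | by apply: (nzM 1%N 4) => //; [rewrite pnatr_eq0|field]
  | by apply: (nzM 2%N 1) => //; [rewrite oner_eq0|field]
  | by apply: (nzM 2%N 2) => //; [rewrite pnatr_eq0|field]
  | by apply: (nzM 1%N 8) => //; [rewrite pnatr_eq0|field]
  | by apply: (nzM 3%N 2) => //; [rewrite pnatr_eq0|field]
  | by apply: (nzM 4%N 1) => //; [rewrite oner_eq0|field]
  | by apply: (nzM 4%N 2) => //; [rewrite pnatr_eq0|field] ].
Qed.
End Frame.

(** * Triangular operators *)

Section Triangular.
Variables (C : numClosedFieldType) (l : nat).
Implicit Types (M N : nat -> nat -> SA C -> SA C) (u v w : SQsp C l).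

Lemma vaddE u v : vadd u v = u + v.
Proof. by apply/ffunP => j; rewrite !ffunE. Qed.

Lemma vscaleE (c : C) u : vscale c u = c *: u.
Proof. by apply/ffunP => j; rewrite !ffunE. Qed.

(** The block [M j d] sends index j to index j + d; recording the shift d instead of the target
    matches [symb], [fsymb] and [quant]. *)
Definition tri M v : SQsp C l :=
  [ffun jo : 'I_l => \sum_(j < l | (j <= jo)%N) M j (jo - j)%N (v j)].

Definition tlinear M := forall j d c (A B : SA C), M j d (c *: A + B) = c *: M j d A + M j d B.

Lemma tlinear0 M j d : tlinear M -> M j d 0 = 0.
Proof.
by move=> linM; have := linM j d 1 0 0; rewrite !scale1r addr0 -{1}(addr0 (M j d 0)) => /addrI.
Qed.

Lemma tri_linear M c u v : tlinear M -> tri M (c *: u + v) = c *: tri M u + tri M v.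
Proof.
move=> linM; apply/ffunP => jo; rewrite !ffunE scaler_sumr -big_split /=.
by apply: eq_bigr => j _; rewrite !ffunE linM.
Qed.

Lemma tlinearZ M j d c (A : SA C) : tlinear M -> M j d (c *: A) = c *: M j d A.
Proof. by move=> linM; have := linM j d c A 0; rewrite tlinear0 // !addr0. Qed.

Lemma triZ M c u : tlinear M -> tri M (c *: u) = c *: tri M u.
Proof.
move=> linM; apply/ffunP => jo; rewrite !ffunE scaler_sumr.
by apply: eq_bigr => j _; rewrite !ffunE tlinearZ.
Qed.

Lemma sum_ord_shift (G : nat -> SA C) (i : nat) (jo : 'I_l) : (i <= jo)%N ->
  \sum_(j < l | (i <= j <= jo)%N) G j = \sum_(d < (jo - i).+1) G (i + d)%N.
Proof.
move=> le_i.
have -> : \sum_(j < l | (i <= j <= jo)%N) G j = \sum_(i <= j < jo.+1) G j.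
  by rewrite big_geq_mkord (big_ord_widen_cond l).
rewrite -{1}(add0n i) big_addn big_mkord subSn //.
by apply: eq_bigr => d _; rewrite addnC.
Qed.

Lemma tri_comp M N v jo : tlinear M ->
  tri M (tri N v) jo = \sum_(i < l | (i <= jo)%N)
    \sum_(d < (jo - i).+1) M (i + d)%N (jo - i - d)%N (N i d (v i)).
Proof.
move=> linM; rewrite ffunE.
have morM j d : {morph M j d : A B / A + B}.
  by move=> A B; have := linM j d 1 A B; rewrite !scale1r.
transitivity (\sum_(j < l | (j <= jo)%N) \sum_(i < l | (i <= j)%N)
    M j (jo - j)%N (N i (j - i)%N (v i))).
  apply: eq_bigr => j _; rewrite ffunE; apply: (big_morph _ (morM _ _)).
  exact: tlinear0.
rewrite (exchange_big_dep (fun i : 'I_l => (i <= jo)%N)) /=; last first.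
  by move=> j i le_j /leq_trans; apply.
apply: eq_bigr => i le_i.
transitivity (\sum_(j < l | (i <= j <= jo)%N) M j (jo - j)%N (N i (j - i)%N (v i))).
  by apply: eq_bigl => j; rewrite andbC.
rewrite (sum_ord_shift (fun j => M j (jo - j)%N (N i (j - i)%N (v i)))) //.
by apply: eq_bigr => d _; rewrite addKn subnDA.
Qed.

Section Unitriangular.
Variable M : nat -> nat -> SA C -> SA C.
Hypotheses (linM : tlinear M) (M0 : forall j A, M j 0 A = A).

(* The equation [tri M x = y] is the fixed point equation of this map, which
   improves agreement by one index at each iteration. *)
Definition tri_step (y x : SQsp C l) : SQsp C l := y - tri M x + x.

Lemma tri_step_agree y u v t :
  (forall i : 'I_l, (i < t)%N -> u i = v i) ->
  forall i : 'I_l, (i < t.+1)%N -> tri_step y u i = tri_step y v i.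
Proof.
move=> uv i lt_i.
(* The diagonal blocks are identities, so the diagonal term cancels the summand [w i] and only
   smaller indices remain. *)
have stepE w : tri_step y w i =
    y i - \sum_(j < l | (j <= i)%N && (j != i)) M j (i - j)%N (w j).
  by rewrite !ffunE (bigD1 i) //= subnn M0 opprD addrA addrAC subrK.
rewrite !stepE; congr (_ - _); apply: eq_bigr => j /andP [le_j ne_j].
by rewrite uv // -ltnS (leq_trans _ lt_i) // ltnS ltn_neqAle ne_j.
Qed.

Lemma tri_step_iter y u v t (i : 'I_l) :
  (i < t)%N -> iter t (tri_step y) u i = iter t (tri_step y) v i.
Proof. by elim: t i => // t IH i; apply: tri_step_agree. Qed.

Definition tri_inv y := iter l (tri_step y) 0.

Lemma tri_step_fix x : tri_step (tri M x) x = x.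
Proof. by rewrite /tri_step subrr add0r. Qed.

(** The vector x is a fixed point of the step for [tri M x], and l iterations forget the starting
    value. *)
Lemma triK : cancel (tri M) tri_inv.
Proof.
move=> x; have fixx t : iter t (tri_step (tri M x)) x = x.
  by elim: t => //= t ->; apply: tri_step_fix.
by rewrite -[RHS](fixx l); apply/ffunP => i; apply: tri_step_iter.
Qed.

Lemma tri_invK : cancel tri_inv (tri M).
Proof.
(* One more step amounts to l steps started from [tri_step y 0] instead of 0. *)
move=> y; have : tri_step y (tri_inv y) = tri_inv y.
  by rewrite /tri_inv -iterS iterSr; apply/ffunP => i; apply: tri_step_iter.
by rewrite /tri_step => /eqP; rewrite -subr_eq0 addrK subr_eq0 => /eqP.
Qed.

Lemma tri_inv_linear c u v : tri_inv (c *: u + v) = c *: tri_inv u + tri_inv v.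
Proof. by apply: (can_inj triK); rewrite tri_linear // !tri_invK. Qed.

Lemma tri_invZ c u : tri_inv (c *: u) = c *: tri_inv u.
Proof. by apply: (can_inj triK); rewrite triZ // !tri_invK. Qed.

Lemma tri_inv_hom p r y : (forall v, sq_hom p r v -> sq_hom p r (tri M v)) ->
  sq_hom p r y -> sq_hom p r (tri_inv y).
Proof.
move=> homM homy.
have hom0 : sq_hom p r (0 : SQsp C l) by move=> j; rewrite ffunE; case: ifP.
suff homI t : sq_hom p r (iter t (tri_step y) 0) by apply: homI.
elim: t => //= t homx j.
have := homy j; have := homx j; have := homM _ homx j; rewrite !ffunE /=.
by case: ifP => _ -> -> ->; rewrite subr0 addr0.
Qed.

End Unitriangular.
End Triangular.

(** * Linearity and parity of the operators *)

Section Families.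
Variables (C : numClosedFieldType).
Implicit Types (A B F T : SA C) (c nu lam mu : C) (q : bool) (P : {poly C}).

Lemma iter_sD_linear d c A B :
  iter d (@sD C) (c *: A + B) = c *: iter d (@sD C) A + iter d (@sD C) B.
Proof. by elim: d => //= d ->; rewrite sDD sDZ. Qed.

Lemma bid_linear m F c A B : bid m F (c *: A + B) = c *: bid m F A + bid m F B.
Proof. by rewrite bidD bidZ. Qed.

Lemma Lact_linear nu F c A B : Lact nu F (c *: A + B) = c *: Lact nu F A + Lact nu F B.
Proof.
apply: scoef_inj => b i.
rewrite /Lact !(sDD, sDZ, bidD, bidZ, scoefD, scoefZ); ring.
Qed.

Lemma symb_linear lam mu nu q e F c A B :
  symb lam mu nu q e F (c *: A + B) = c *: symb lam mu nu q e F A + symb lam mu nu q e F B.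
Proof.
case: e => [|e] /=; first exact: Lact_linear.
by rewrite bid_linear scalerDr !scalerA mulrC.
Qed.

Lemma fbid_linear nu r F c A B :
  fbid nu r F (c *: A + B) = c *: fbid nu r F A + fbid nu r F B.
Proof.
apply: scoef_inj => b i.
case: r => [|[|[|[|[|[|r]]]]]] /=; rewrite -?scaleNr;
 rewrite !(sDD, sDZ, bidD, bidZ, scoefD, scoefZ, scoef0); ring.
Qed.

Lemma fsymb_linear lam mu nu q r F c A B :
  fsymb lam mu nu q r F (c *: A + B) = c *: fsymb lam mu nu q r F A + fsymb lam mu nu q r F B.
Proof.
case: r => [|r]; first exact: Lact_linear.
by rewrite /fsymb fbid_linear scalerDr !scalerA mulrC.
Qed.

Lemma quant_linear lam mu nu q d c A B :
  quant lam mu nu q d (c *: A + B) = c *: quant lam mu nu q d A + quant lam mu nu q d B.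
Proof. by rewrite /quant iter_sD_linear scalerDr !scalerA mulrC. Qed.

Lemma ssigD A B : ssig (A + B) = ssig A + ssig B.
Proof. exact: (iter_sigD 1). Qed.

Lemma ssigZ c A : ssig (c *: A) = c *: ssig A.
Proof. exact: (iter_sigZ 1). Qed.

Lemma ssig0 : ssig (0 : SA C) = 0.
Proof. by rewrite /ssig /= oppr0. Qed.

Lemma sD_sig A : sD (ssig A) = - ssig (sD A).
Proof. by case: A => A0 A1; rewrite /ssig /sD /=; congr pair => //=; rewrite opprK. Qed.

(** D^m(F) has parity f + m and sigma is multiplicative. This is the source of the signs carried by
    an odd equivalence. *)
Lemma ssig_bid m (f : bool) P T :
  ssig (bid m (shom f P) T) = (-1) ^+ (f + m) *: bid m (shom f P) (ssig T).
Proof.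
have sigM A B : ssig (smul A B) = smul (ssig A) (ssig B).
  by rewrite /ssig /smul /=; congr pair; rewrite mulNr mulrN opprD.
have sig_shom : ssig (iter m (@sD C) (shom f P)) = (-1) ^+ (f + m) *: iter m (@sD C) (shom f P).
  elim: m => [|m IH] /=.
    by case: f; rewrite /ssig /= ?scale1r ?scaleN1r ?oppr0 //; congr pair; rewrite /= ?oppr0.
  by rewrite addnS exprS -scalerA -sDZ -IH sD_sig scaleN1r opprK.
rewrite /bid sigM sig_shom -iterS iterSr.
by rewrite /smul /= -!scalerAl -scalerDr.
Qed.

Lemma ssig_Lact nu (f : bool) P T :
  ssig (Lact nu (shom f P) T) = (-1) ^+ f *: Lact nu (shom f P) (ssig T).
Proof.
apply: scoef_inj => b i.
rewrite /Lact !(ssigD, ssigZ, ssig_bid, sD_sig) -!scaleN1r.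
rewrite !(sDZ, bidZ, sD_sig) -!scaleN1r !(bidZ, scoefD, scoefZ) !exprD.
ring.
Qed.

Lemma ssig_fbid nu r (f : bool) P T :
  ssig (fbid nu r (shom f P) T) = (-1) ^+ (f + r) *: fbid nu r (shom f P) (ssig T).
Proof.
apply: scoef_inj => b i.
case: r => [|[|[|[|[|[|r]]]]]] /=; rewrite -?scaleNr.
all: rewrite ?ssig0 ?scaler0 //.
all: rewrite !(ssigD, ssigZ, ssig_bid, sD_sig) -?scaleN1r.
all: rewrite ?(sDZ, bidZ, sD_sig) -?scaleN1r ?(sDZ, bidZ) ?(scoefD, scoefZ) !exprD.
all: ring.
Qed.

Lemma ssig_fsymb lam mu nu q r (f : bool) P T :
  ssig (fsymb lam mu nu q r (shom f P) T)
  = (-1) ^+ (f + r) *: fsymb lam mu nu q r (shom f P) (ssig T).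
Proof.
case: r => [|r]; first by rewrite addn0; apply: ssig_Lact.
by rewrite /fsymb ssigZ ssig_fbid !scalerA mulrC.
Qed.

Lemma iter_sig0 m : iter m (@ssig C) 0 = 0.
Proof. by elim: m => //= m ->; apply: ssig0. Qed.

Lemma iter_sigK m : involutive (iter m (@ssig C)).
Proof.
have ssigK B : ssig (ssig B) = B by case: B => B0 B1; rewrite /ssig /= opprK.
by elim: m => // m IH A; rewrite [iter m.+1 _ A]iterS iterSr ssigK IH.
Qed.

Lemma iter_sig_hom m (b : bool) A : (if b then A.1 = 0 else A.2 = 0) ->
  if b then (iter m (@ssig C) A).1 = 0 else (iter m (@ssig C) A).2 = 0.
Proof. by move=> A0; elim: m => //= m; case: b {A0} => /= ->; rewrite ?oppr0. Qed.

Lemma iter_sig_fsymb (e : bool) lam mu nu q r (f : bool) P T :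
  iter e (@ssig C) (fsymb lam mu nu q r (shom f P) T)
  = (-1) ^+ (e && (f (+) odd r)) *: fsymb lam mu nu q r (shom f P) (iter e (@ssig C) T).
Proof.
case: e => /=; last by rewrite scale1r.
by rewrite ssig_fsymb -signr_odd oddD oddb.
Qed.

End Families.

(** * The split module *)

Section Module.
Variables (C : numClosedFieldType) (n lam mu : C) (p : bool).
Implicit Types (P : {poly C}) (v : SQsp C 6).

(** The density weight of the graded piece of index j. *)
Definition colw (j : nat) : C := n + j%:R / 2.

Definition symbs F j e := symb lam mu (colw j) (p (+) odd j) e F.
Definition fsymbs F j r := fsymb lam mu (colw j) (p (+) odd j) r F.
Definition quants j d := quant lam mu (colw j) (p (+) odd j) d.

Definition frame_act (f : bool) P v : SQsp C 6 := tri (fsymbs (shom f P)) v.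

Lemma symbs_linear F : tlinear (symbs F).
Proof. by move=> j d c A B; apply: symb_linear. Qed.

Lemma fsymbs_linear F : tlinear (fsymbs F).
Proof. by move=> j d c A B; apply: fsymb_linear. Qed.

Lemma quants_linear : tlinear quants.
Proof. by move=> j d c A B; apply: quant_linear. Qed.

Lemma quants0 j A : quants j 0 A = A.
Proof. by rewrite /quants /quant scale1r. Qed.

Lemma colwD j d : colw (j + d) = colw j + d%:R / 2.
Proof. by rewrite /colw natrD mulrDl addrA. Qed.

Lemma sqact_tri f P v :
  sqact (mu - lam - n) lam mu p f P v = tri (symbs (shom f P)) v.
Proof.
apply/ffunP => jo; rewrite !ffunE.
transitivity (\sum_(j < 6) contrib (mu - lam - n) lam mu p f (shom f P) (v j) j jo); first by [].
rewrite (bigID (fun j : 'I_6 => (j <= jo)%N)) /= [X in _ + X]big1 ?addr0; last first.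
  by move=> j; rewrite -ltnNge => /contrib_gt ->.
apply: eq_bigr => j le_j; rewrite -{1}(subnKC le_j) contrib_symb //.
by rewrite (leq_ltn_trans (leq_subr _ _)).
Qed.

(** This excludes exactly n = 0, -1/2, -1, -3/2, -2. *)
Hypothesis nz : forall t, (t < 5)%N -> colw t != 0.

Lemma sqact_quants f P v :
  sqact (mu - lam - n) lam mu p f P (tri quants v) = tri quants (frame_act f P v).
Proof.
rewrite sqact_tri; apply/ffunP => jo.
rewrite (tri_comp _ _ _ (symbs_linear _)) (tri_comp _ _ _ quants_linear).
apply: eq_bigr => i le_i.
rewrite /symbs /fsymbs /quants.
have lt_e : (jo - i < 6)%N by rewrite (leq_ltn_trans (leq_subr _ _)).
have nz_e t : (t < jo - i)%N -> colw i + t%:R / 2 != 0.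
  move=> lt_t; rewrite -colwD nz //; have := ltn_ord jo; lia.
have := quant_intertwine lam mu (p (+) odd i) (shom f P) (v i) lt_e nz_e.
under eq_bigr do rewrite -colwD -addbA -oddD.
under [in RHS]eq_bigr do rewrite -colwD -addbA -oddD.
by apply.
Qed.

(** Each D flips the parity of the coefficient while each index shift flips that of the power of
    Dbar, so the total parity is kept. *)
Lemma quants_hom r v : sq_hom p r v -> sq_hom p r (tri quants v).
Proof.
have comp_sum b (I : finType) (Q : pred I) (G : I -> SA C) :
    (forall i, Q i -> if b then (G i).1 = 0 else (G i).2 = 0) ->
    if b then (\sum_(i | Q i) G i).1 = 0 else (\sum_(i | Q i) G i).2 = 0.
  move=> G0; elim/big_ind: _ => //; first by case: b {G0}.
  by move=> A B; case: b {G0} => /= -> ->; rewrite addr0.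
move=> homv jo; rewrite ffunE; apply: comp_sum => j le_j.
have := homv j; rewrite -{1}(subnKC le_j) oddD addbA.
move: (v j) (r (+) p (+) odd j) => T b; rewrite /quants /quant.
have hD d : (if b then T.1 = 0 else T.2 = 0) ->
    if b (+) odd d then (iter d (@sD C) T).1 = 0 else (iter d (@sD C) T).2 = 0.
  move=> T0; elim: d => [|d] /=; first by rewrite addbF.
  by rewrite addbN; case: (b (+) odd d) => /= ->; rewrite ?deriv0.
by move=> /(hD (jo - j)%N); case: (b (+) _) => /= ->; rewrite scaler0.
Qed.

Definition frame_inv := tri_inv quants (l := 6).

Lemma sqact_frame_inv f P v :
  frame_inv (sqact (mu - lam - n) lam mu p f P v) = frame_act f P (frame_inv v).
Proof.
apply: (can_inj (triK quants0)).
by rewrite /frame_inv tri_invK -?sqact_quants ?tri_invK //; exact: quants0.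
Qed.

End Module.

(** * Equivalences from diagonal scalings *)

Section Sufficiency.
Variables (C : numClosedFieldType) (n lam mu lam' mu' : C) (p p' : bool).
Implicit Types (P : {poly C}) (v : SQsp C 6).

Definition sqkap (lam mu : C) (p : bool) (j r : nat) : C :=
  kap lam mu (colw n j) (p (+) odd j) r.

Hypothesis nz : forall t, (t < 5)%N -> colw n t != 0.

(** A diagonal map of the split frames respects the density actions, and the relations on c make it
    respect the supertransvectant terms. Conjugation by the two quantizations gives the
    equivalence. *)
Lemma SQequiv_of_scaling (c : nat -> C) :
  (forall j, c j != 0) ->
  (forall j r, (0 < r)%N -> (j + r < 6)%N ->
     sqkap lam mu p j r * c (j + r)%N = sqkap lam' mu' p' j r * c j) ->
  SQequiv 6 (mu - lam - n) p lam mu (mu' - lam' - n) p' lam' mu'.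
Proof.
(* Coefficients keep their parity under the diagonal map, so the total parity shifts by p + p'. *)
move=> c_nz cK; pose e := p (+) p'.
(* When e is odd, applying sigma produces the sign (-1)^(f+r) on the block of shift r; the factor
   (-1)^j removes (-1)^r and leaves the required (-1)^f. *)
pose d j := (-1) ^+ (e && odd j) * c j.
pose Dg v : SQsp C 6 := [ffun j : 'I_6 => d j *: iter e (@ssig C) (v j)].
pose Dg' v : SQsp C 6 := [ffun j : 'I_6 => (d j)^-1 *: iter e (@ssig C) (v j)].
have d_nz j : d j != 0 by rewrite mulf_neq0 ?signr_eq0.
have DgK : cancel Dg Dg'.
  by move=> v; apply/ffunP => j; rewrite !ffunE iter_sigZ scalerA mulVf // scale1r iter_sigK.
have Dg'K : cancel Dg' Dg.
  by move=> v; apply/ffunP => j; rewrite !ffunE iter_sigZ scalerA mulfV // scale1r iter_sigK.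
have Dg_lin (a : C) u v : Dg (a *: u + v) = a *: Dg u + Dg v.
  apply/ffunP => j; rewrite !ffunE iter_sigD iter_sigZ scalerDr !scalerA.
  by rewrite [a * _]mulrC.
have Dg_act f P v : Dg (frame_act n lam mu p f P v)
    = (-1) ^+ (e && f) *: frame_act n lam' mu' p' f P (Dg v).
  apply/ffunP => jo; rewrite !ffunE.
  rewrite (big_morph _ (iter_sigD e) (iter_sig0 _ e)).
  rewrite !scaler_sumr; apply: eq_bigr => j le_j; rewrite !ffunE.
  rewrite /fsymbs -[X in d X](subnKC le_j).
  have : (j + (jo - j) < 6)%N by rewrite subnKC.
  move: (jo - j)%N (v j) => r T lt_r.
  rewrite iter_sig_fsymb; move: (iter _ _ T) => U.
  have := tlinearZ j r (d j) U (@fsymbs_linear C n lam' mu' p' (shom f P)).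
  rewrite /fsymbs => ->; rewrite !scalerA.
  case: r lt_r => [|r] lt_r; first by rewrite addn0 addbF mulrC.
  rewrite /fsymb !scalerA; congr (_ *: _).
  have := cK j r.+1 isT lt_r; rewrite /sqkap => cKj.
  have sgn : (-1) ^+ (e && odd (j + r.+1)) * (-1) ^+ (e && (f (+) odd r.+1))
      = (-1) ^+ (e && f) * (-1) ^+ (e && odd j) :> C.
    rewrite -!signr_addb -!andb_addr oddD; congr ((-1) ^+ (nat_of_bool (_ && _))).
    by case: (odd j); case: (odd r.+1); case: (f).
  rewrite /d mulrA [X in X * _]mulrAC sgn -[LHS]mulrA [c _ * _]mulrC cKj.
  by move: (kap _ _ _ _ _) (c j) => x y; ring.
pose qz := @quants C n lam mu p; pose qz' := @quants C n lam' mu' p'.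
exists (fun v => tri qz' (Dg (frame_inv n lam mu p v))), e; split.
- move=> a u v; rewrite !vaddE !vscaleE.
  rewrite -tri_linear ?/qz'; last exact: quants_linear.
  rewrite -Dg_lin /frame_inv tri_inv_linear //.
  + exact: quants_linear.
  + exact: quants0.
- exists (fun v => tri qz (Dg' (frame_inv n lam' mu' p' v))) => v.
  + by rewrite /frame_inv triK ?DgK ?tri_invK //; exact: quants0.
  + by rewrite /frame_inv triK ?Dg'K ?tri_invK //; exact: quants0.
- move=> r v homv.
  have {homv} : sq_hom p r (frame_inv n lam mu p v).
    by apply: tri_inv_hom homv => u; apply: quants_hom.
  move: (frame_inv _ _ _ _ _) => {}v homv; apply: quants_hom => j.
  have := homv j; rewrite ffunE; move: (v j) => T.
  have -> : r (+) e (+) p' (+) odd j = r (+) p (+) odd j.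
    by rewrite /e; case: (r); case: (p); case: (p'); case: (odd j).
  by move=> /(iter_sig_hom e); case: ifP => _ /= ->; rewrite scaler0.
- move=> f P v; rewrite vscaleE sqact_frame_inv // Dg_act sqact_quants //.
  by rewrite triZ //; apply: quants_linear.
Qed.

End Sufficiency.

(** * Test vectors and the action of osp(1|2) *)

Section Vectors.
Variables (C : numClosedFieldType).
Implicit Types (A F T : SA C) (nu : C) (P : {poly C}).

Definition single (j : nat) T : SQsp C 6 := [ffun i : 'I_6 => if i == j :> nat then T else 0].

Lemma singleZ j c T : single j (c *: T) = c *: single j T.
Proof. by apply/ffunP => i; rewrite !ffunE; case: eqP => // _; rewrite scaler0. Qed.

Lemma single0 j : single j 0 = 0.
Proof. by apply/ffunP => i; rewrite !ffunE; case: eqP. Qed.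

Lemma single_sum (v : SQsp C 6) : v = \sum_(i < 6) single i (v i).
Proof.
apply/ffunP => i; rewrite sum_ffunE (bigD1 i) //= ffunE eqxx big1 ?addr0 // => j ne_ji.
by rewrite ffunE; case: eqP => // E; case/eqP: ne_ji; apply: val_inj.
Qed.

Lemma tri_single M (j : nat) T (i : 'I_6) : tlinear M ->
  tri M (single j T) i = if (j <= i)%N then M j (i - j)%N T else 0.
Proof.
move=> linM; rewrite ffunE; case: leqP => [le_j|lt_j].
  have lt6 : (j < 6)%N by apply: leq_ltn_trans (ltn_ord i).
  rewrite (bigD1 (Ordinal lt6)) //= ffunE eqxx big1 ?addr0 // => k /andP [_ ne_k].
  rewrite ffunE; case: eqP => [E|_]; last by rewrite tlinear0.
  by case/eqP: ne_k; apply: val_inj.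
rewrite big1 // => k le_k; rewrite ffunE; case: eqP => [E|_]; last by rewrite tlinear0.
by move: le_k; rewrite E leqNgt lt_j.
Qed.

Lemma Lact_even nu P T : Lact nu (shom false P) T =
  (P * T.1^`() + nu *: (P^`() * T.1),
   P * T.2^`() + (1 / 2) *: (P^`() * T.2) + nu *: (P^`() * T.2)).
Proof.
rewrite /Lact /bid; apply: SA_eqP => /=.
all: rewrite ?(deriv0, mul0r, opprK, scaler0, add0r, addr0) //.
all: by rewrite ?(mulr0, mul0r, scaler0, add0r, addr0).
Qed.

Lemma Lact_odd nu P T : Lact nu (shom true P) T =
  ((1 / 2) *: (P * T.2), (1 / 2) *: (P * T.1^`()) + nu *: (P^`() * T.1)).
Proof.
rewrite /Lact /bid; apply: SA_eqP => /=.
all: rewrite ?(deriv0, mul0r, mulr0, opprK, scaler0, add0r, addr0) //.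
apply: poly_eq_horner => x.
by rewrite !(hornerD, hornerN, hornerZ, hornerM, horner0); field.
Qed.

Lemma bid_eq0 m k F T : iter m (@sD C) F = 0 -> (m <= k)%N -> bid k F T = 0.
Proof.
move=> F0 le_m; rewrite /bid -(subnK le_m) iterD F0.
have -> d : iter d (@sD C) 0 = 0 by elim: d => //= d ->; rewrite sD0.
by rewrite /smul /= !mul0r add0r.
Qed.

(** The functions killed by D^5 are spanned by 1, x, x^2, xi, xi x, hence give osp(1|2), and every
    supertransvectant puts at least five D on F. *)
Lemma fsymb_osp lam mu nu q r F T : iter 5 (@sD C) F = 0 ->
  fsymb lam mu nu q r.+1 F T = 0.
Proof.
move=> F0; rewrite /fsymb; case: r => [|[|[|[|[|r]]]]] /=; rewrite ?scaler0 //.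
all: by rewrite !(bid_eq0 _ F0) // !(scaler0, subr0, addr0).
Qed.

Lemma frame_act_osp n lam mu p (f : bool) P v (i : 'I_6) :
  iter 5 (@sD C) (shom f P) = 0 ->
  frame_act n lam mu p f P v i = Lact (colw n i) (shom f P) (v i).
Proof.
move=> F0; rewrite ffunE (bigD1 i) //= subnn big1 ?addr0 // => j /andP [le_j ne_j].
have : (0 < i - j)%N by rewrite subn_gt0 ltn_neqAle le_j andbT.
by rewrite /fsymbs; case: (i - j)%N => // r _; apply: fsymb_osp.
Qed.

Lemma bid0 m F : bid m F 0 = 0.
Proof. by have := bidZ m F 0 0; rewrite !scale0r. Qed.

Lemma fsymb_one lam mu nu q r F : (0 < r)%N -> fsymb lam mu nu q r F (1, 0) =
  kap lam mu nu q r *: match r with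
    | 3 => iter 5 (@sD C) F | 4 => nu *: iter 6 (@sD C) F | 5 => nu *: iter 7 (@sD C) F
    | _ => 0 end.
Proof.
have bid1 m : bid m F (1, 0) = iter m (@sD C) F.
  have sig1 : iter m (@ssig C) (1, 0) = (1, 0) by elim: m => //= m ->; rewrite /ssig /= oppr0.
  by rewrite /bid sig1 /smul /= !mulr1 mulr0 addr0; case: (iter m _ F).
have D1 : @sD C (1, 0) = 0 by rewrite /sD /= derivC.
case: r => [|[|[|[|[|[|r]]]]]] //= _; rewrite ?bid1 ?D1 ?sD0 //.
all: by rewrite !bid0 !(scaler0, subr0, addr0).
Qed.

Lemma deriv_one : (1 : {poly C})^`() = 0.
Proof. by rewrite -polyC1 derivC. Qed.

Lemma derivXnZ a : ('X^a : {poly C})^`() = a%:R *: 'X^(a.-1).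
Proof. by rewrite derivXn scaler_nat. Qed.

Lemma deriv_eq0 P : P^`() = 0 -> P = (P`_0)%:P.
Proof.
move=> P'0; apply/polyP => i; rewrite coefC; case: i => //= i.
have := coef_deriv P i; rewrite P'0 coef0 => /esym /eqP.
by rewrite mulrn_eq0 /= => /eqP.
Qed.

Lemma osp_even P : P^`()^`()^`() = 0 -> iter 5 (@sD C) (shom false P) = 0.
Proof. by move=> P0; rewrite /= /sD /= P0 !deriv0. Qed.

Lemma osp_odd P : P^`()^`() = 0 -> iter 5 (@sD C) (shom true P) = 0.
Proof. by move=> P0; rewrite /= /sD /= P0 !deriv0. Qed.

End Vectors.

Section Necessity.
Variables (C : numClosedFieldType) (n lam mu lam' mu' : C) (p p' : bool).
Implicit Types (P : {poly C}) (v : SQsp C 6).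

Lemma frame_act_single (f : bool) P j T (i : 'I_6) :
  frame_act n lam mu p f P (single j T) i =
  if (j <= i)%N then fsymb lam mu (colw n j) (p (+) odd j) (i - j) (shom f P) T else 0.
Proof. by rewrite /frame_act tri_single //; apply: fsymbs_linear. Qed.

Lemma frame_act_single_osp (f : bool) P j T :
  iter 5 (@sD C) (shom f P) = 0 ->
  frame_act n lam mu p f P (single j T) = single j (Lact (colw n j) (shom f P) T).
Proof.
move=> F0; apply/ffunP => i; rewrite frame_act_osp // !ffunE.
case: eqP => [-> //|_].
by rewrite /Lact !sD0 !bid0 !scaler0 !addr0.
Qed.

End Necessity.

(** * Equivalences of split modules *)

Section Intertwiner.
Variables (C : numClosedFieldType) (n lam mu lam' mu' : C) (p p' : bool).
Implicit Types (P : {poly C}) (v : SQsp C 6).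

Hypothesis nz : forall t, (t < 5)%N -> colw n t != 0.

(** An equivalence read in the two split frames; s stands for the sign (-1)^e of its parity e. *)
Variables (psi : SQsp C 6 -> SQsp C 6) (s : C).
Hypothesis psi_linear : forall c u v, psi (c *: u + v) = c *: psi u + psi v.
Hypothesis psi_inj : injective psi.
Hypothesis psi_act : forall (f : bool) P v,
  psi (frame_act n lam mu p f P v) = s ^+ f *: frame_act n lam' mu' p' f P (psi v).
Hypothesis s2 : s ^+ 2 = 1.

Lemma psi0 : psi 0 = 0.
Proof.
by have := psi_linear 1 0 0; rewrite !scale1r addr0 -{1}(addr0 (psi 0)) => /addrI.
Qed.

Lemma psiZ c v : psi (c *: v) = c *: psi v.
Proof. by have := psi_linear c v 0; rewrite psi0 !addr0. Qed.

Lemma s_neq0 : s != 0.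
Proof. by apply: contra_eq_neq s2 => ->; rewrite expr0n eq_sym oner_eq0. Qed.

(* The vectors killed by d/dx and d/dxi are the constants, on which the Euler
   field acts with the distinct weights n + j/2. *)
Lemma psi_vacuum (j : 'I_6) :
  exists2 c : C, c != 0 & psi (single j (1, 0)) = c *: single j (1, 0).
Proof.
set e := single j (1, 0); set w := psi e.
have osp_w (f : bool) P : iter 5 (@sD C) (shom f P) = 0 -> forall i : 'I_6,
    psi (single j (Lact (colw n j) (shom f P) (1, 0))) i
    = s ^+ f *: Lact (colw n i) (shom f P) (w i).
  move=> F0 i; rewrite -(frame_act_single_osp n lam mu p j _ F0) psi_act ffunE.
  by rewrite frame_act_osp.
have w_dx i : (w i).1^`() = 0.
  have := osp_w false 1; rewrite osp_even; last by rewrite deriv_one !deriv0.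
  move=> /(_ erefl i).
  rewrite !Lact_even /= !(deriv_one, deriv0, mul1r, mul0r, mulr0, scaler0, addr0).
  by rewrite single0 psi0 ffunE scale1r => /esym /(congr1 fst).
have w_odd i : (w i).2 = 0.
  have := osp_w true 1; rewrite osp_odd; last by rewrite deriv_one !deriv0.
  move=> /(_ erefl i).
  rewrite !Lact_odd /= !(deriv_one, deriv0, mul1r, mul0r, mulr0, scaler0, addr0).
  rewrite single0 psi0 ffunE => /esym /eqP; rewrite scaler_eq0 expf_eq0 (negPf s_neq0) andbF /=.
  move=> /eqP /(congr1 fst) /= /eqP; rewrite scaler_eq0 => /orP [|/eqP //].
  by rewrite invr_eq0 pnatr_eq0.
have w_weight (i : 'I_6) : colw n j *: w i = colw n i *: w i.
  have := osp_w false 'X; rewrite osp_even; last by rewrite derivX deriv_one !deriv0.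
  move=> /(_ erefl i); rewrite !Lact_even derivX w_odd w_dx /=.
  rewrite !(deriv_one, deriv0, mul1r, mul0r, mulr0, scaler0, addr0, add0r) expr0 scale1r.
  have -> : (colw n j *: 1, 0) = colw n j *: (1, 0) :> SA C.
    by apply: SA_eqP => //=; rewrite scaler0.
  rewrite singleZ psiZ ffunE -/e -/w => ->.
  by apply: SA_eqP; rewrite /= ?w_odd ?scaler0.
have w_off (i : 'I_6) : i != j -> w i = 0.
  move=> ne_ij; have /eqP := w_weight i; rewrite -subr_eq0 -scalerBl scaler_eq0.
  case/orP => [|/eqP //]; rewrite /colw opprD addrACA subrr add0r -mulrBl.
  rewrite mulf_eq0 invr_eq0 pnatr_eq0 orbF subr_eq0 eqr_nat => /eqP E.
  by case/eqP: ne_ij; apply: val_inj.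
have w_e : w = (w j).1`_0 *: e.
  apply/ffunP => i; rewrite !ffunE; case: eqP => [E|ne_ij].
    have -> : i = j by apply: val_inj.
    apply: SA_eqP; rewrite /= ?w_odd ?scaler0 //.
    by rewrite {1}(deriv_eq0 (w_dx j)) alg_polyC.
  by rewrite scaler0 w_off //; apply: contra_notN ne_ij => /eqP ->.
exists (w j).1`_0 => //; apply: contra_eqN w_e => /eqP c0.
rewrite c0 scale0r -psi0 (inj_eq psi_inj).
apply/eqP => /ffunP /(_ j); rewrite !ffunE eqxx => /(congr1 fst) /eqP.
by rewrite oner_eq0.
Qed.

Variable c : nat -> C.
Hypothesis psi_c : forall j, psi (single j (1, 0)) = c j *: single j (1, 0).

(** Both split modules carry the same diagonal osp(1|2)-action, so a scalar known on A propagates to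
    its image, with a factor s when the field is odd. *)
Lemma psi_raise (f : bool) P j (A T : SA C) (k c0 : C) :
  iter 5 (@sD C) (shom f P) = 0 -> k != 0 ->
  Lact (colw n j) (shom f P) A = k *: T ->
  psi (single j A) = c0 *: single j A ->
  psi (single j T) = (s ^+ f * c0) *: single j T.
Proof.
move=> F0 k0 AT psiA; apply: (scalerI k0).
rewrite -psiZ -singleZ -AT -(frame_act_single_osp n lam mu p j A F0) psi_act psiA.
rewrite /frame_act triZ; last exact: fsymbs_linear.
rewrite -/(frame_act n lam' mu' p' f P (single j A)) frame_act_single_osp // AT.
by rewrite singleZ !scalerA [k * _]mulrC mulrA.
Qed.

(** In weight nu the field of x^2 sends x^a to (a + 2 nu) x^(a+1), and xi x^a to (a + 1 + 2 nu) xi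
    x^(a+1). With nu = n + j/2, a + 2 nu is twice the weight of index j + a. *)
Lemma colw2_neq0 j a : (j + a < 5)%N -> a%:R + 2 * colw n j != 0.
Proof.
move=> lt5; have -> : a%:R + 2 * colw n j = 2 * colw n (j + a).
  by rewrite colwD; field.
by rewrite mulf_neq0 ?pnatr_eq0 ?nz.
Qed.

Lemma osp_sq : iter 5 (@sD C) (shom false 'X^2) = 0.
Proof. by apply: osp_even; rewrite derivXn expr1 derivMn derivX derivMn deriv_one mul0rn. Qed.

Lemma psi_even j a : (j + a <= 5)%N ->
  psi (single j ('X^a, 0)) = c j *: single j ('X^a, 0).
Proof.
elim: a => [|a IH] le5; first exact: psi_c.
rewrite -[c j]mul1r; apply: (psi_raise osp_sq (k := a%:R + 2 * colw n j) (A := ('X^a, 0))).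
- by apply: colw2_neq0; lia.
- rewrite Lact_even; apply: SA_eqP => /=; last by rewrite deriv0 !mulr0 !scaler0 !addr0.
  rewrite !derivXnZ; apply: poly_eq_horner => x; case: a {IH le5} => [|a].
    by rewrite !(hornerD, hornerZ, hornerM, hornerXn) /= ?exprS; ring.
  by rewrite !(hornerD, hornerZ, hornerM, hornerXn) /= ?exprS; ring.
- by apply: IH; lia.
Qed.

(** The field of xi x sends 1 to nu xi, which brings in the factor s; the field of x^2 then raises
    the power of x. *)
Lemma psi_odd j a : (j + a < 5)%N ->
  psi (single j (0, 'X^a)) = (s * c j) *: single j (0, 'X^a).
Proof.
elim: a => [|a IH] lt5.
  apply: (psi_raise (f := true) (P := 'X) (A := (1, 0)) (k := colw n j)).
  + by apply: osp_odd; rewrite derivX deriv_one.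
  + by apply: nz; lia.
  + rewrite Lact_odd; apply: SA_eqP => /=; first by rewrite mulr0 !scaler0.
    by rewrite deriv_one derivX mulr0 scaler0 add0r mul1r.
  + exact: psi_c.
rewrite -[s * c j]mul1r; apply: (psi_raise osp_sq (k := a.+1%:R + 2 * colw n j) (A := (0, 'X^a))).
- by apply: colw2_neq0; lia.
- rewrite Lact_even; apply: SA_eqP => /=; first by rewrite deriv0 !mulr0 !scaler0 !addr0.
  rewrite !derivXnZ; apply: poly_eq_horner => x; case: a {IH lt5} => [|a].
    by rewrite !(hornerD, hornerZ, hornerM, hornerXn) /= ?exprS; field.
  by rewrite !(hornerD, hornerZ, hornerM, hornerXn) /= ?exprS; field.
- by apply: IH; lia.
Qed.

(* Both sides are evaluated at the component of index j + r; all the components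
   of [frame_act f P (single j 1)] below it must be diagonal for psi. *)
Lemma psi_compare (f : bool) P (j r : nat) (k : C) :
  (0 < r)%N -> (j + r < 6)%N -> k != 0 ->
  (forall lam mu p, fsymb lam mu (colw n j) (p (+) odd j) r (shom f P) (1, 0) =
     (sqkap n lam mu p j r * k) *: (1, 0)) ->
  (forall d, d != r -> (j + d < 6)%N ->
     exists k', psi (single (j + d) (fsymb lam mu (colw n j) (p (+) odd j) d (shom f P) (1, 0)))
       = k' *: single (j + d) (fsymb lam mu (colw n j) (p (+) odd j) d (shom f P) (1, 0))) ->
  sqkap n lam mu p j r * c (j + r)%N = s ^+ f * (sqkap n lam' mu' p' j r * c j).
Proof.
move=> r_gt0 lt6 k0 top diag.
pose m := Ordinal lt6; set v := frame_act n lam mu p f P (single j (1, 0)).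
have v_m : v m = (sqkap n lam mu p j r * k) *: (1, 0).
  by rewrite /v frame_act_single /= leq_addr addKn top.
have psi_v : psi v m = (sqkap n lam mu p j r * k * c (j + r)%N) *: (1, 0).
  have psi_sum (I : Type) (t : seq I) (G : I -> SQsp C 6) :
      psi (\sum_(i <- t) G i) = \sum_(i <- t) psi (G i).
    have psiD : {morph psi : u w / u + w}.
      by move=> u w; have := psi_linear 1 u w; rewrite !scale1r.
    exact: (big_morph psi psiD psi0).
  rewrite {1}[v]single_sum psi_sum sum_ffunE (bigD1 m) //= big1 ?addr0.
    by rewrite v_m singleZ psiZ psi_c !ffunE eqxx !scalerA.
  move=> i ne_im; suff [k' ->] : exists k', psi (single i (v i)) = k' *: single i (v i).
    rewrite !ffunE; case: eqP => [E|_]; last by rewrite scaler0.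
    by case/eqP: ne_im; apply/val_inj/esym/E.
  rewrite /v frame_act_single; case: leqP => [le_ji|_]; last first.
    by exists 0; rewrite single0 psi0 scaler0.
  rewrite -{1 3}(subnKC le_ji); apply: diag; last by rewrite subnKC.
  by apply: contra ne_im => /eqP E; apply/eqP/val_inj; rewrite /= -E subnKC.
have := psi_v; rewrite /v psi_act psi_c /frame_act triZ; last exact: fsymbs_linear.
rewrite -/(frame_act n lam' mu' p' f P (single j (1, 0))).
have scaleE x (u : SQsp C 6) : (x *: u) m = x *: u m by rewrite ffunE.
rewrite !scaleE frame_act_single /= leq_addr addKn top !scalerA.
move/(congr1 (fun A : SA C => A.1`_0)) => /=.
rewrite !coefZ coef1 /= !mulr1 => E; apply: (mulIf k0).
by rewrite mulrAC -E; ring.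
Qed.

(** The test functions are xi x^2, x^3, xi x^3 for r = 3, 4, 5. Their supertransvectant of order r
    with 1 is a nonzero constant, while each other component is zero or a multiple of a vector
    handled by [psi_even] or [psi_odd]. *)
Lemma kap_rel j r : (2 < r < 6)%N -> (j + r < 6)%N ->
  sqkap n lam mu p j r * c (j + r)%N = s ^+ r * (sqkap n lam' mu' p' j r * c j).
Proof.
have s_odd t : s ^+ t = s ^+ odd t.
  by rewrite -{1}(odd_double_half t) exprD -mul2n exprM s2 expr1n mulr1.
have zero j' T : T = 0 -> exists k', psi (single j' T) = k' *: single j' T.
  by move=> ->; exists 0; rewrite single0 psi0 scaler0.
have scaled j' k T : (exists k', psi (single j' T) = k' *: single j' T) ->
    exists k', psi (single j' (k *: T)) = k' *: single j' (k *: T).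
  by move=> [k' E]; exists k'; rewrite singleZ psiZ E !scalerA mulrC.
have evenk j' k a : (j' + a <= 5)%N ->
    exists k', psi (single j' (k *: ('X^a, 0))) = k' *: single j' (k *: ('X^a, 0)).
  by move=> h; apply: scaled; exists (c j'); apply: psi_even.
have oddk j' k a : (j' + a < 5)%N ->
    exists k', psi (single j' (k *: (0, 'X^a))) = k' *: single j' (k *: (0, 'X^a)).
  by move=> h; apply: scaled; exists (s * c j'); apply: psi_odd.
have low d (lam0 mu0 nu : C) q F : (0 < d < 3)%N -> fsymb lam0 mu0 nu q d F (1, 0) = 0.
  by case: d => [|[|[|d]]] // _; rewrite fsymb_one // scaler0.
have dX2 : ('X^2 : {poly C})^`() = 2 *: 'X by rewrite derivXnZ.
have dX2' : ('X^2 : {poly C})^`()^`() = 2 *: 1 by rewrite dX2 derivZ derivX.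
have dX3 : ('X^3 : {poly C})^`() = 3 *: 'X^2 by rewrite derivXnZ.
have dX3' : ('X^3 : {poly C})^`()^`() = 6 *: 'X.
  by rewrite dX3 derivZ dX2 scalerA -natrM.
have dX3'' : ('X^3 : {poly C})^`()^`()^`() = 6 *: 1 by rewrite dX3' derivZ derivX.
have d1 : (1 : {poly C})^`() = 0 := deriv_one C.
have pairZl k (P : {poly C}) : (k *: P, 0) = k *: (P, 0) :> SA C.
  by apply: SA_eqP; rewrite //= scaler0.
have pairZr k (P : {poly C}) : (0, k *: P) = k *: (0, P) :> SA C.
  by apply: SA_eqP; rewrite //= scaler0.
have pair0 : (0, 0) = 0 :> SA C by [].
move=> r_in lt6; rewrite s_odd.
have : [|| r == 3, r == 4 | r == 5]%N by lia.
case/or3P => /eqP E; rewrite E in lt6 *.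
- apply: (psi_compare (f := true) (P := 'X^2) (k := 2)) => //.
  + by rewrite pnatr_eq0.
  + move=> lam0 mu0 p0; rewrite fsymb_one // -scalerA; congr (_ *: _).
    by rewrite /= /sD /= dX2' !deriv0 pairZl.
  + move=> d ne_d lt_d.
    have : [|| d == 0, 0 < d < 3, d == 4 | d == 5]%N by lia.
    case/or4P => [/eqP -> | /low -> | /eqP -> | /eqP ->]; rewrite ?addn0.
    * rewrite /fsymb Lact_odd /= d1 dX2 !(mulr0, scaler0, add0r) mulr1 scalerA pairZr.
      by apply: (oddk _ _ 1%N); lia.
    * by apply: zero.
    * by apply: zero; rewrite fsymb_one //= /sD /= dX2' derivZ d1 !(scaler0, deriv0, pair0).
    * by apply: zero; rewrite fsymb_one //= /sD /= dX2' derivZ d1 !(scaler0, deriv0, pair0).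
- apply: (psi_compare (f := false) (P := 'X^3) (k := 6 * colw n j)) => //.
  + by rewrite mulf_neq0 ?pnatr_eq0 ?nz //; lia.
  + move=> lam0 mu0 p0; rewrite fsymb_one // -scalerA; congr (_ *: _).
    by rewrite /= /sD /= dX3'' !deriv0 pairZl scalerA mulrC.
  + move=> d ne_d lt_d.
    have : [|| d == 0, 0 < d < 3, d == 3 | d == 5]%N by lia.
    case/or4P => [/eqP -> | /low -> | /eqP -> | /eqP ->]; rewrite ?addn0.
    * rewrite /fsymb Lact_even /= d1 deriv0 dX3 !(mulr0, scaler0, add0r, addr0) mulr1 scalerA pairZl.
      by apply: evenk; lia.
    * by apply: zero.
    * rewrite fsymb_one //= /sD /= dX3'' !deriv0 pairZr scalerA -(expr0 'X).
      by apply: oddk; lia.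
    * by apply: zero; rewrite fsymb_one //= /sD /= dX3'' derivZ d1 !(scaler0, deriv0, pair0).
- apply: (psi_compare (f := true) (P := 'X^3) (k := 6 * colw n j)) => //.
  + by rewrite mulf_neq0 ?pnatr_eq0 ?nz //; lia.
  + move=> lam0 mu0 p0; rewrite fsymb_one // -scalerA; congr (_ *: _).
    by rewrite /= /sD /= dX3'' !deriv0 pairZl scalerA mulrC.
  + move=> d ne_d lt_d.
    have : [|| d == 0, 0 < d < 3, d == 3 | d == 4]%N by lia.
    case/or4P => [/eqP -> | /low -> | /eqP -> | /eqP ->]; rewrite ?addn0.
    * rewrite /fsymb Lact_odd /= d1 dX3 !(mulr0, scaler0, add0r) mulr1 scalerA pairZr.
      by apply: oddk; lia.
    * by apply: zero.
    * rewrite fsymb_one //= /sD /= dX3' !deriv0 pairZl scalerA.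
      by apply: (evenk _ _ 1%N); lia.
    * rewrite fsymb_one //= /sD /= dX3'' !deriv0 pairZr !scalerA -(expr0 'X).
      by apply: oddk; lia.
Qed.
End Intertwiner.

(** * The criterion for equivalence *)

Section Criterion.
Variables (C : numClosedFieldType) (n : C).
Hypothesis nz : forall t, (t < 5)%N -> colw n t != 0.
Implicit Types (lam mu : C) (p : bool).

(** Conversely to the diagonal construction, an equivalence conjugated by the quantizations scales
    the lowest weight vectors, and its scalars satisfy the relations up to a sign. *)
Lemma SQequiv_scalingP lam mu p lam' mu' p' :
  SQequiv 6 (mu - lam - n) p lam mu (mu' - lam' - n) p' lam' mu' <->
  exists2 c : nat -> C, (forall j, c j != 0) &
    forall j r, (2 < r < 6)%N -> (j + r < 6)%N ->
      sqkap n lam mu p j r * c (j + r)%N = sqkap n lam' mu' p' j r * c j.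
Proof.
split=> [[phi [e [phi_lin phi_bij _ phi_act]]]|[c c0 cK]]; last first.
  apply: (SQequiv_of_scaling nz c0) => j r _ lt6.
  have [r_in|] := boolP (2 < r < 6)%N; first exact: cK.
  by case: r {lt6} => [|[|[|[|[|[|r]]]]]] //= _; rewrite /sqkap /= !mul0r.
pose qz := @quants C n lam mu p; pose qz' := @quants C n lam' mu' p'.
have qzK : cancel (tri qz (l := 6)) (tri_inv qz) by apply: triK; apply: quants0.
have qzK' : cancel (tri_inv qz') (tri qz' (l := 6)) by apply: tri_invK; apply: quants0.
pose psi v := frame_inv n lam' mu' p' (phi (tri qz v)).
pose s : C := (-1) ^+ e.
have psi_lin c u v : psi (c *: u + v) = c *: psi u + psi v.
  rewrite /psi tri_linear; last exact: quants_linear.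
  rewrite -vscaleE -vaddE phi_lin vscaleE vaddE /frame_inv tri_inv_linear //.
  - exact: quants_linear.
  - exact: quants0.
have psi_inj : injective psi.
  move=> u v /(can_inj qzK') /(bij_inj phi_bij); exact: (can_inj qzK).
have psi_act (f : bool) P v :
    psi (frame_act n lam mu p f P v) = s ^+ f *: frame_act n lam' mu' p' f P (psi v).
  rewrite /psi /qz -(sqact_quants lam mu p nz f P v) phi_act vscaleE.
  have -> : s ^+ f = (-1) ^+ (e && f) by rewrite /s; case: (e); case: (f); rewrite ?expr1n.
  rewrite -(sqact_frame_inv lam' mu' p' nz) /frame_inv tri_invZ //.
  - exact: quants_linear.
  - exact: quants0.
have s2 : s ^+ 2 = 1 by rewrite sqrr_sign.
have vac i := psi_vacuum psi_lin psi_inj psi_act s2 i.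
have [c c0 psi_c] := fin_all_exists2 vac.
(* From index 6 on [single j] is zero, and any nonzero value will do. *)
pose c' j := if insub j is Some i then c i else 1.
have c'0 j : c' j != 0 by rewrite /c'; case: insub => [i|]; rewrite ?c0 ?oner_eq0.
have psi_c' j : psi (single j (1, 0)) = c' j *: single j (1, 0).
  rewrite /c'; case: insubP => [i _ <-|ge6]; first exact: psi_c.
  suff -> : single j (1, 0) = 0 :> SQsp C 6 by rewrite scaler0; apply: psi0 psi_lin.
  apply/ffunP => i; rewrite !ffunE; case: eqP => // E; case/negP: ge6; rewrite -E.
  exact: ltn_ord.
(* The twist by s^j absorbs the sign s^r of [kap_rel]. *)
exists (fun j => s ^+ j * c' j) => [j|j r r_in lt6].
  by rewrite mulf_neq0 // expf_neq0 // signr_eq0.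
have := kap_rel nz psi_lin psi_act s2 psi_c' r_in lt6.
move: (sqkap n lam mu p j r) (sqkap n lam' mu' p' j r) (c' (j + r)%N) (c' j) => x y u w E.
have ss : s ^+ r * s ^+ r = 1 by rewrite -exprD addnn -mul2n exprM s2 expr1n.
rewrite mulrCA E exprD; transitivity (s ^+ j * (s ^+ r * s ^+ r) * (y * w)); first by ring.
by rewrite ss; ring.
Qed.

(** The factor sqrt 3 occurs exactly where B^q is odd in gamma^(1/2). *)
Definition gain (nu : C) (q : bool) (r : nat) : C :=
  match r with
  | 3 => - (if q then 12 * (nu + 1 / 2) else sqrtC 3 * (4 * (nu + 1 / 2)))^-1
  | 4 => - (24 * nu * (nu + 3 / 2))^-1
  | _ => ((if q then sqrtC 3 else 1) * (24 * nu * (nu + 1) * (nu + 2)))^-1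
  end.

Lemma sqrtC3_neq0 : sqrtC 3 != 0 :> C.
Proof. by rewrite sqrtC_eq0 pnatr_eq0. Qed.

(** With nu = n + j/2 and q = p + j, the falling factorial in S starts at delta - nu for q = 0 and
    at delta - nu - 1/2 for q = 1, whatever p is, as in [kap]. *)
Lemma kap_gain lam mu p j r : (2 < r < 6)%N -> (j + r < 6)%N ->
  gain (colw n j) (p (+) odd j) r != 0 /\
  sqkap n lam mu p j r = gain (colw n j) (p (+) odd j) r * Sf n lam mu p (j + r) j.
Proof.
move=> r_in lt6.
have nzM t c y : (t < 5)%N -> c != 0 -> y = c * (n + t%:R / 2) -> y != 0.
  by move=> /nz nzt c0 ->; apply: mulf_neq0.
have w0 := sqrtC3_neq0; have w2 : sqrtC 3 ^+ 2 = 3 :> C by apply: sqrtCK.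
have w3 : sqrtC 3 ^+ 3 = 3 * sqrtC 3 :> C by rewrite exprS w2 mulrC.
have : (j < 3)%N by lia.
case: j lt6 => [|[|[|]]] // lt6 _; case: r r_in lt6 => [|[|[|[|[|[|]]]]]] // _ _.
all: rewrite /sqkap /kap /gain /Sf /Bat /Bf /gam12 /colw /=.
all: case: p => /=.
all: rewrite ?ffall1 ?ffall2 ?ffall3 ?exprMn ?w2 ?w3.
all: move: (sqrtC 3) w0 => w w0; split; last field.
all: rewrite ?oppr_eq0 ?invr_eq0 ?mulf_eq0 ?negb_or ?pnatr_eq0 ?oner_eq0 /=.
all: repeat (apply/andP; split); rewrite ?w0 //.
all: first [ by apply: (nzM 0%N 1) => //; [rewrite oner_eq0|field]
  | by apply: (nzM 1%N 1) => //; [rewrite oner_eq0|field]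
  | by apply: (nzM 1%N 2) => //; [rewrite pnatr_eq0|field]
  | by apply: (nzM 2%N 1) => //; [rewrite oner_eq0|field]
  | by apply: (nzM 2%N 2) => //; [rewrite pnatr_eq0|field]
  | by apply: (nzM 3%N 1) => //; [rewrite oner_eq0|field]
  | by apply: (nzM 3%N 2) => //; [rewrite pnatr_eq0|field]
  | by apply: (nzM 4%N 1) => //; [rewrite oner_eq0|field]
  | by apply: (nzM 4%N 2) => //; [rewrite pnatr_eq0|field] ].
Qed.

(** The right side is free of q: either both factors contain sqrt 3 or neither does. Hence the
    constants agree even when p and p' differ. *)
Lemma gain_cycle nu nu' q :
  gain nu q 5 * gain nu' (~~ q) 3 = - (12 * (24 * nu * (nu + 1) * (nu + 2)) * (nu' + 1 / 2))^-1.
Proof.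
have w2 : sqrtC 3 * sqrtC 3 = 3 :> C by rewrite -expr2 sqrtCK.
rewrite /gain mulrN -invfM; congr (- _^-1).
case: q => /=; last by ring.
by rewrite mulrACA w2; ring.
Qed.

(* The edges j -> j + r of the graph carrying the six equations form a single
   cycle 0 - 4 - 1 - 5 - 0. *)
Lemma scaling_exists (x y : nat -> nat -> C) :
  (forall j r, (2 < r < 6)%N -> (j + r < 6)%N -> (x j r == 0) = (y j r == 0)) ->
  x 0%N 5%N * x 1%N 3%N * (y 0%N 4%N * y 1%N 4%N)
    = y 0%N 5%N * y 1%N 3%N * (x 0%N 4%N * x 1%N 4%N) ->
  exists2 c : nat -> C, (forall j, c j != 0) &
    forall j r, (2 < r < 6)%N -> (j + r < 6)%N -> x j r * c (j + r)%N = y j r * c j.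
Proof.
(* The ratio of c at the ends of an edge; an edge with zero entries imposes nothing and gets 1. *)
move=> xy0 cyc; pose t j r := if x j r == 0 then 1 else y j r / x j r.
have t0 j r : (2 < r < 6)%N -> (j + r < 6)%N -> t j r != 0.
  move=> r_in lt6; rewrite /t; case: ifP => [_|/negbT x0]; first by rewrite oner_eq0.
  by rewrite mulf_neq0 ?invr_eq0 // -xy0.
have xt j r : (2 < r < 6)%N -> (j + r < 6)%N -> x j r * t j r = y j r.
  move=> r_in lt6; rewrite /t; case: ifP => [/eqP x0|/negbT x0]; last by rewrite mulrC divfK.
  by rewrite x0 mul0r; apply/esym/eqP; rewrite -xy0 // x0.
have [c1 [c4 [c5 [[n1 n4 n5] [e04 e05 e13 e14]]]]] : exists c1 c4 c5 : C,
    [/\ c1 != 0, c4 != 0 & c5 != 0] /\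
    [/\ x 0%N 4%N * c4 = y 0%N 4%N, x 0%N 5%N * c5 = y 0%N 5%N,
        x 1%N 3%N * c4 = y 1%N 3%N * c1 & x 1%N 4%N * c5 = y 1%N 4%N * c1].
  have [t04 t05 t13 t14] := And4 (t0 0%N 4%N isT isT)
    (t0 0%N 5%N isT isT) (t0 1%N 3%N isT isT) (t0 1%N 4%N isT isT).
  (* A zero entry on an edge cuts the cycle, and values propagate along the remaining path. If the
     first three entries are nonzero, the cycle identity yields the relation on the last edge. *)
  have [x04|x04] := eqVneq (x 0%N 4%N) 0.
    exists (t 0%N 5%N / t 1%N 4%N), (t 1%N 3%N * (t 0%N 5%N / t 1%N 4%N)), (t 0%N 5%N).
    rewrite !mulf_neq0 ?invr_eq0 //; split=> //; split.
    - by rewrite -xt // x04 !mul0r.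
    - exact: xt.
    - by rewrite mulrA xt.
    - by rewrite -(xt 1%N 4%N) // -mulrA [t 1%N 4%N * _]mulrC divfK.
  have [x05|x05] := eqVneq (x 0%N 5%N) 0.
    exists (t 0%N 4%N / t 1%N 3%N), (t 0%N 4%N), (t 1%N 4%N * (t 0%N 4%N / t 1%N 3%N)).
    rewrite !mulf_neq0 ?invr_eq0 //; split=> //; split.
    - exact: xt.
    - by rewrite -xt // x05 !mul0r.
    - by rewrite -(xt 1%N 3%N) // -mulrA [t 1%N 3%N * _]mulrC divfK.
    - by rewrite mulrA xt.
  have [x13|x13] := eqVneq (x 1%N 3%N) 0.
    exists (t 0%N 5%N / t 1%N 4%N), (t 0%N 4%N), (t 0%N 5%N).
    rewrite !mulf_neq0 ?invr_eq0 //; split=> //; split.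
    - exact: xt.
    - exact: xt.
    - by rewrite -(xt 1%N 3%N) // x13 !mul0r.
    - by rewrite -(xt 1%N 4%N) // -mulrA [t 1%N 4%N * _]mulrC divfK.
  exists (t 0%N 4%N / t 1%N 3%N), (t 0%N 4%N), (t 0%N 5%N).
  rewrite !mulf_neq0 ?invr_eq0 //; split=> //; split.
  - exact: xt.
  - exact: xt.
  - by rewrite -(xt 1%N 3%N) // -mulrA [t 1%N 3%N * _]mulrC divfK.
  apply: (mulIf t13); rewrite -(xt 1%N 4%N) // -!mulrA [_^-1 * _]mulrC mulrV ?unitfE // mulr1.
  have x0 : x 0%N 5%N * x 1%N 3%N * x 0%N 4%N != 0 by rewrite !mulf_neq0.
  apply: (mulfI x0); move: cyc; rewrite -!xt //.
  move: (x 0%N 5%N) (x 1%N 3%N) (x 0%N 4%N) (x 1%N 4%N) (t 0%N 4%N) (t 0%N 5%N) (t 1%N 3%N) (t 1%N 4%N).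
  move=> a b d e u v w z E; transitivity (a * v * (b * w) * (d * e)); first by ring.
  by rewrite -E; ring.
(* The vertices 2 and 3 hang off the cycle by the single edges 2 - 5 and 0 - 3. *)
exists (nth 1 [:: 1; c1; c5 / t 2%N 3%N; t 0%N 3%N; c4; c5]) => [j|j r r_in lt6].
  move: j => [|[|[|[|[|[|j]]]]]] //=; rewrite ?nth_nil ?oner_eq0 ?t0 //.
  by rewrite mulf_neq0 ?invr_eq0 ?t0.
have : (j < 3)%N by lia.
case: j lt6 => [|[|[|]]] // lt6 _; case: r r_in lt6 => [|[|[|[|[|[|]]]]]] //= _ _.
all: rewrite ?mulr1 ?xt //.
by rewrite -(xt 2%N 3%N) // -mulrA [t _ _ * _]mulrC divfK ?t0.
Qed.

(** Equality of holonomies is cross-multiplied, so one criterion also covers vanishing entries. The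
    gains drop out by [gain_cycle] and because those with r = 4 do not involve the parity. *)
Theorem SQequivP lam mu p lam' mu' p' :
  SQequiv 6 (mu - lam - n) p lam mu (mu' - lam' - n) p' lam' mu' <->
  SVC 6 n p lam mu p' lam' mu' /\
  Sf n lam mu p 5 0 * Sf n lam mu p 4 1 * (Sf n lam' mu' p' 4 0 * Sf n lam' mu' p' 5 1)
  = Sf n lam' mu' p' 5 0 * Sf n lam' mu' p' 4 1 * (Sf n lam mu p 4 0 * Sf n lam mu p 5 1).
Proof.
have SVCP : SVC 6 n p lam mu p' lam' mu' <->
    forall j r, (2 < r < 6)%N -> (j + r < 6)%N ->
      (sqkap n lam mu p j r == 0) = (sqkap n lam' mu' p' j r == 0).
  have sf0 lam0 mu0 p0 j r : (2 < r < 6)%N -> (j + r < 6)%N ->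
      (sqkap n lam0 mu0 p0 j r == 0) = (Sf n lam0 mu0 p0 (j + r) j == 0).
    by move=> r_in lt6; have [g0 ->] := kap_gain lam0 mu0 p0 r_in lt6; rewrite mulf_eq0 (negPf g0).
  split=> [svc j r r_in lt6|kap0 a b le_a le_b ab_in].
    by rewrite !sf0 //; apply: svc; lia.
  by have := kap0 b (a - b)%N; rewrite !sf0 ?subnKC //; apply; lia.
have cycP : sqkap n lam mu p 0 5 * sqkap n lam mu p 1 3
      * (sqkap n lam' mu' p' 0 4 * sqkap n lam' mu' p' 1 4)
    = sqkap n lam' mu' p' 0 5 * sqkap n lam' mu' p' 1 3
      * (sqkap n lam mu p 0 4 * sqkap n lam mu p 1 4) <->
  Sf n lam mu p 5 0 * Sf n lam mu p 4 1 * (Sf n lam' mu' p' 4 0 * Sf n lam' mu' p' 5 1)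
  = Sf n lam' mu' p' 5 0 * Sf n lam' mu' p' 4 1 * (Sf n lam mu p 4 0 * Sf n lam mu p 5 1).
  have [[g05 ->] [g13 ->]] := (kap_gain lam mu p (isT : (2 < 5 < 6)%N) (isT : (0 + 5 < 6)%N),
                               kap_gain lam mu p (isT : (2 < 3 < 6)%N) (isT : (1 + 3 < 6)%N)).
  have [[g04 ->] [g14 ->]] := (kap_gain lam mu p (isT : (2 < 4 < 6)%N) (isT : (0 + 4 < 6)%N),
                               kap_gain lam mu p (isT : (2 < 4 < 6)%N) (isT : (1 + 4 < 6)%N)).
  have [[_ ->] [_ ->]] := (kap_gain lam' mu' p' (isT : (2 < 5 < 6)%N) (isT : (0 + 5 < 6)%N),
                           kap_gain lam' mu' p' (isT : (2 < 3 < 6)%N) (isT : (1 + 3 < 6)%N)).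
  have [[_ ->] [_ ->]] := (kap_gain lam' mu' p' (isT : (2 < 4 < 6)%N) (isT : (0 + 4 < 6)%N),
                           kap_gain lam' mu' p' (isT : (2 < 4 < 6)%N) (isT : (1 + 4 < 6)%N)).
  move: g05 g13 g04 g14; rewrite !addbF !addbT !add0n !add1n.
  have gE : gain (colw n 0) p 5 * gain (colw n 1) (~~ p) 3
          = gain (colw n 0) p' 5 * gain (colw n 1) (~~ p') 3 by rewrite !gain_cycle.
  move=> g05 g13 g04 g14.
  have -> : gain (colw n 0) p' 4 = gain (colw n 0) p 4 by [].
  have -> : gain (colw n 1) (~~ p') 4 = gain (colw n 1) (~~ p) 4 by [].
  move: (Sf _ _ _ _ _ _) (Sf _ _ _ _ _ _) (Sf _ _ _ _ _ _) (Sf _ _ _ _ _ _)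
        (Sf _ _ _ _ _ _) (Sf _ _ _ _ _ _) (Sf _ _ _ _ _ _) (Sf _ _ _ _ _ _).
  move=> s6 s5 s4 s3 s2 s1 t4 t3; move: gE g05 g13 g04 g14.
  move: (gain _ p 5) (gain _ (~~ p) 3) (gain _ p' 5) (gain _ (~~ p') 3) (gain _ p 4) (gain _ (~~ p) 4).
  move=> a b a' b' d e gE a0 b0 d0 e0.
  have K0 : a * b * (d * e) != 0 by rewrite !mulf_neq0.
  have -> : a * t3 * (b * t4) * (d * s1 * (e * s2)) = a * b * (d * e) * (t3 * t4 * (s1 * s2)) by ring.
  have -> : a' * s3 * (b' * s4) * (d * s5 * (e * s6)) = a * b * (d * e) * (s3 * s4 * (s5 * s6)).
    by rewrite gE; ring.
  by split=> [/(mulfI K0)|->].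
rewrite SQequiv_scalingP SVCP -cycP; split=> [[c c0 cK]|[]]; last exact: scaling_exists.
split=> [j r r_in lt6|].
  have := congr1 (fun z => z == 0) (cK j r r_in lt6).
  by rewrite !mulf_eq0 !(negPf (c0 _)) !orbF.
have [e05 e13] := (cK 0%N 5%N isT isT, cK 1%N 3%N isT isT).
have [e04 e14] := (cK 0%N 4%N isT isT, cK 1%N 4%N isT isT).
have K0 : c 5%N * c 4%N * (c 0%N * c 1%N) != 0 by rewrite !mulf_neq0.
apply: (mulIf K0); move: e05 e13 e04 e14; rewrite !add0n !add1n.
move: (sqkap n lam mu p 0 5) (sqkap n lam mu p 1 3) (sqkap n lam mu p 0 4) (sqkap n lam mu p 1 4).
move: (sqkap n lam' mu' p' 0 5) (sqkap n lam' mu' p' 1 3) (sqkap n lam' mu' p' 0 4) (sqkap n lam' mu' p' 1 4).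
move: (c 0%N) (c 1%N) (c 4%N) (c 5%N) => c_0 c_1 c_4 c_5 y05 y13 y04 y14 x05 x13 x04 x14 e05 e13 e04 e14.
transitivity ((x05 * c_5) * (x13 * c_4) * ((y04 * c_0) * (y14 * c_1))); first by ring.
by rewrite e05 e13 -e04 -e14; ring.
Qed.

End Criterion.

(** * The cycle invariant and its degenerate cases *)

Section Invariant.
Variables (C : numClosedFieldType) (n : C).
Implicit Types (lam mu : C) (p : bool).

Definition cycle_zero p lam mu : bool :=
  has (fun ab : nat * nat => Sf n lam mu p ab.1 ab.2 == 0) [:: (5, 0); (4, 1); (5, 1); (4, 0)]%N.

(** The falling factorial at (5/2, 0) has roots 0, 1, 2, which include those of the other three. *)
Lemma cycle_zero_even lam mu :
  cycle_zero false lam mu = (mu - lam - n \in [:: 0; 1; 2]) || Ifactor_zero false n lam mu.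
Proof.
rewrite /cycle_zero /Ifactor_zero /Sf /= !inE -[_ == 1]subr_eq0 -[_ == 2]subr_eq0.
have -> : mu - lam - n - 2 = mu - lam - n - 1 - 1 by ring.
rewrite ffall1 !ffall2 ffall3 !subr0 !mulf_eq0.
have -> : mu - lam - n - 2 = mu - lam - n - 1 - 1 by ring.
by do 7 case: (_ == 0).
Qed.

Lemma cycle_zero_odd lam mu :
  cycle_zero true lam mu = (mu - lam - n \in [:: 1 / 2; 3 / 2]) || Ifactor_zero true n lam mu.
Proof.
rewrite /cycle_zero /Ifactor_zero /Sf /= !inE -[_ == 1 / 2]subr_eq0 -[_ == 3 / 2]subr_eq0.
have -> : mu - lam - n - 3 / 2 = mu - lam - n - 1 / 2 - 1 by field.
rewrite !ffall2 !subr0 !mulf_eq0.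
by do 7 case: (_ == 0).
Qed.

(** The falling factorials cancel: for p = 0, (x)_3 (x - 1)_1 = (x)_2 (x - 1)_2 with x = delta - n,
    and for p = 1 all four coincide. *)
Lemma Ifun_cycle p lam mu : ~~ cycle_zero p lam mu ->
  Sf n lam mu p 4 0 * Sf n lam mu p 5 1 != 0 /\
  Ifun p n lam mu = Sf n lam mu p 5 0 * Sf n lam mu p 4 1 / (Sf n lam mu p 4 0 * Sf n lam mu p 5 1).
Proof.
rewrite /cycle_zero /= !negb_or /= => /and5P [s50 s41 s51 s40 _].
split; first by rewrite mulf_neq0.
move: s50 s41 s51 s40; rewrite /Ifun /Sf; case: p => /=.
- rewrite !ffall2 !subr0.
  move: (Bat _ _ _ true 5 0) (Bat _ _ _ false 4 1) (Bat _ _ _ false 5 1) (Bat _ _ _ true 4 0).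
  move: (mu - lam - n - 1 / 2) => x a b c d; rewrite !mulf_eq0 !negb_or.
  case/andP => /andP [x0 x1] a0 /andP [_ b0] /andP [_ c0] /andP [_ d0].
  by field; rewrite c0 d0 x0 x1.
- rewrite ffall1 !ffall2 ffall3 !subr0.
  move: (Bat _ _ _ false 5 0) (Bat _ _ _ true 4 1) (Bat _ _ _ true 5 1) (Bat _ _ _ false 4 0).
  move: (mu - lam - n) => x a b c d.
  have -> : x - 1 - 1 = x - 2 by ring.
  rewrite !mulf_eq0 !negb_or.
  case/andP => /andP [/andP [x0 x1] x2] a0 /andP [_ b0] /andP [_ c0] /andP [_ d0].
  by field; rewrite c0 d0 x0 x1 x2.
Qed.

(** By the SVC a vanishing entry vanishes for both modules, and each side of the identity contains
    one of the two. *)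
Lemma cycle_identity p lam mu p' lam' mu' : SVC 6 n p lam mu p' lam' mu' ->
  cycle_zero p lam mu || cycle_zero p' lam' mu' ->
  Sf n lam mu p 5 0 * Sf n lam mu p 4 1 * (Sf n lam' mu' p' 4 0 * Sf n lam' mu' p' 5 1)
  = Sf n lam' mu' p' 5 0 * Sf n lam' mu' p' 4 1 * (Sf n lam mu p 4 0 * Sf n lam mu p 5 1).
Proof.
move=> svc; have -> : cycle_zero p' lam' mu' = cycle_zero p lam mu.
  by rewrite /cycle_zero /= !svc.
rewrite orbb /cycle_zero /= orbF.
have [e50 e41 e51 e40] := And4 (svc 5 0 isT isT isT) (svc 4 1 isT isT isT)
  (svc 5 1 isT isT isT) (svc 4 0 isT isT isT).
case/or4P => /eqP z; [move: e50|move: e41|move: e51|move: e40];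
 by rewrite z eqxx => /esym /eqP ->; rewrite !(mul0r, mulr0).
Qed.

End Invariant.

(** * The classification by parities *)

Theorem theorem4p4 (R : realType) (n : R[i]) (p p' : bool) (lam mu lam' mu' : R[i]) :
  n \notin [:: 0; - (1 / 2); -1; - (3 / 2); -2] ->
  (SQequiv 6 (mu - lam - n) p lam mu (mu' - lam' - n) p' lam' mu' ->
     SVC 6 n p lam mu p' lam' mu') /\
  (* (i) p = p' = 0 *)
  (p = false -> p' = false ->
     let cond := [|| mu - lam - n \in [:: 0; 1; 2], mu' - lam' - n \in [:: 0; 1; 2],
                     Ifactor_zero false n lam mu | Ifactor_zero false n lam' mu'] in
     (cond -> SVC 6 n p lam mu p' lam' mu' ->
        SQequiv 6 (mu - lam - n) p lam mu (mu' - lam' - n) p' lam' mu') /\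
     (~~ cond ->
        (SQequiv 6 (mu - lam - n) p lam mu (mu' - lam' - n) p' lam' mu' <->
         SVC 6 n p lam mu p' lam' mu' /\ Ifun false n lam mu = Ifun false n lam' mu'))) /\
  (* (ii) p = p' = 1 *)
  (p = true -> p' = true ->
     let cond := [|| mu - lam - n \in [:: 1 / 2; 3 / 2], mu' - lam' - n \in [:: 1 / 2; 3 / 2],
                     Ifactor_zero true n lam mu | Ifactor_zero true n lam' mu'] in
     (cond -> SVC 6 n p lam mu p' lam' mu' ->
        SQequiv 6 (mu - lam - n) p lam mu (mu' - lam' - n) p' lam' mu') /\
     (~~ cond ->
        (SQequiv 6 (mu - lam - n) p lam mu (mu' - lam' - n) p' lam' mu' <->
         SVC 6 n p lam mu p' lam' mu' /\ Ifun true n lam mu = Ifun true n lam' mu'))) /\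
  (* (iii) p = 0, p' = 1;  (i,j) in {(5/2,0),(2,1/2),(5/2,1/2),(2,0)} *)
  (p = false -> p' = true ->
     let cond := has (fun ab : nat * nat =>
                        (Sf n lam mu false ab.1 ab.2 == 0) ||
                        (Sf n lam' mu' true ab.1 ab.2 == 0))
                     [:: (5, 0); (4, 1); (5, 1); (4, 0)]%N in
     (cond -> SVC 6 n p lam mu p' lam' mu' ->
        SQequiv 6 (mu - lam - n) p lam mu (mu' - lam' - n) p' lam' mu') /\
     (~~ cond ->
        (SQequiv 6 (mu - lam - n) p lam mu (mu' - lam' - n) p' lam' mu' <->
         SVC 6 n p lam mu p' lam' mu' /\ Ifun false n lam mu = Ifun true n lam' mu'))).
Proof.
move=> n_notin.
have nz t : (t < 5)%N -> colw n t != 0.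
  move=> lt5; apply: contra n_notin; rewrite /colw addr_eq0 => /eqP ->.
  have E : 4 / 2 = 2 :> R[i] by field.
  case: t lt5 => [|[|[|[|[|t]]]]] // _; rewrite !inE.
  - by rewrite mul0r oppr0 eqxx.
  - by rewrite eqxx orbT.
  - by rewrite divff ?pnatr_eq0 // eqxx !orbT.
  - by rewrite eqxx !orbT.
  - by rewrite E eqxx !orbT.
have equivP := SQequivP nz lam mu p lam' mu' p'.
(* All three cases are this dichotomy, once their conditions are recognized as a zero entry on the
   cycle. *)
have main (cond : bool) : cond = cycle_zero n p lam mu || cycle_zero n p' lam' mu' ->
    (cond -> SVC 6 n p lam mu p' lam' mu' ->
        SQequiv 6 (mu - lam - n) p lam mu (mu' - lam' - n) p' lam' mu') /\
    (~~ cond ->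
        (SQequiv 6 (mu - lam - n) p lam mu (mu' - lam' - n) p' lam' mu' <->
         SVC 6 n p lam mu p' lam' mu' /\ Ifun p n lam mu = Ifun p' n lam' mu')).
  move=> ->; split=> [z svc|]; first by apply/equivP; split=> //; apply: cycle_identity.
  rewrite negb_or => /andP [/Ifun_cycle [s0 ->] /Ifun_cycle [s0' ->]].
  rewrite equivP; split=> -[svc E]; split=> //.
    by apply/eqP; rewrite eqr_div // E.
  by apply/eqP; rewrite -eqr_div // E.
split; first by case/equivP.
split; [|split] => p_val p'_val cond; rewrite p_val p'_val in main *; apply: main.
- by rewrite /cond !cycle_zero_even orbACA -!orbA.
- by rewrite /cond !cycle_zero_odd orbACA -!orbA.
- rewrite /cond /cycle_zero /=.
  by do 8 case: (_ == 0).
Qed.
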